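(* Let $((E,\pi,M),[\,,]_{E,h},(\rho,\mathrm{Id}_M))$ be a generalized Lie algebroid, where $h:M\to M$ is a diffeomorphism, and let $g\in\mathcal T^0_2(h^*E,h^*\pi,M)$ be a (pseudo)metrical structure on $h^*E$. Then the local real functions $$\rho\Gamma_{bc}^a=\tfrac12\tilde g^{ad}\Big((\rho_c^k\circ h)\frac{\partial g_{bd}}{\partial x^k}+(\rho_b^j\circ h)\frac{\partial g_{dc}}{\partial x^j}-(\rho_d^l\circ h)\frac{\partial g_{bc}}{\partial x^l}-(L_{bc}^e\circ h)g_{ed}-(L_{bd}^e\circ h)g_{ec}+(L_{dc}^e\circ h)g_{eb}\Big)$$ are the components of a linear $\rho$-connection $\rho\Gamma$ for the vector bundle $(h^*E,h^*\pi,M)$ such that $(\rho,h)\mathbb T=0$ and such that $\rho\Gamma$ is compatible with $g$ (so that $(h^*E,h^*\pi,M)$ becomes $\rho$-(pseudo)metrizable). In the particular case $h=\mathrm{Id}_M$ (Lie algebroids) this reads $\rho\Gamma_{bc}^a=\frac12\tilde g^{ad}\big(\rho_c^k\frac{\partial g_{bd}}{\partial x^k}+\rho_b^j\frac{\partial g_{dc}}{\partial x^j}-\rho_d^l\frac{\partial g_{bc}}{\partial x^l}-L_{bc}^eg_{ed}-L_{bd}^eg_{ec}+L_{dc}^eg_{eb}\big)$, and in the classical case $E=TM$, $\rho=\mathrm{Id}_{TM}$, $h=\mathrm{Id}_M$ with coordinate frames it reads $\Gamma_{jk}^i=\frac12\tilde g^{ih}\big(\frac{\partial g_{jh}}{\partial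 x^k}+\frac{\partial g_{hk}}{\partial x^j}-\frac{\partial g_{jk}}{\partial x^h}\big)$.
   Context: All objects are smooth; repeated indices are summed; $\mathcal F(M)=C^\infty(M,\mathbb R)$. For a vector bundle morphism $(\varphi,\varphi_0)$ covering a diffeomorphism $\varphi_0$, $\Gamma(\varphi,\varphi_0)$ denotes the map on sections $(\Gamma(\varphi,\varphi_0)u)(y)=\varphi(u(\varphi_0^{-1}(y)))$. Generalized Lie algebroid $((E,\pi,M),[\,,]_{E,h},(\rho,\mathrm{Id}_M))$ for a diffeomorphism $h:M\to M$: a vector bundle $E\to M$, a vector bundle morphism $(\rho,\mathrm{Id}_M):E\to TM$, and an operation $[\,,]_{E,h}$ on $\Gamma(E)$ such that: (1) $[u,fv]_{E,h}=f[u,v]_{E,h}+\big(\Gamma(Th\circ\rho,h)(u)f\big)v$; (2) $[\,,]_{E,h}$ makes $\Gamma(E)$ a Lie algebra ($\mathbb R$-bilinear, antisymmetric, Jacobi); (3) $\Gamma(Th\circ\rho,h):\Gamma(E)\to\Gamma(TM)$ is a Lie algebra morphism. Local data: for a local frame $(s_a)$ of $E$ over $V$ put $[s_a,s_b]_{E,h}=L_{ab}^cs_c$. In coordinates $(x^i)$ on $U\subset M$, the functions $\rho_a^i\circ h$ on $U\cap h^{-1}(V)$ are defined by $\big(\Gamma(Th\circ\rho,h)(u)f\big)(h(x))=u^a(h(x))(\rho_a^i\circ h)(x)\frac{\partial(f\circ h)}{\partial x^i}(x)$ for all $u\in\Gamma(E)$ with $u=u^as_a$ on $V$ and all $f\in\mathcal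 F(M)$. The pull-back bundle $h^*E\to M$, with local frame $S_a(x)=s_a(h(x))$ and dual frame $S^a$, is a Lie algebroid over $M$ with anchor $U^aS_a\mapsto U^a(\rho_a^i\circ h)\frac{\partial}{\partial x^i}$ and bracket determined by $[S_a,S_b]_{h^*E}=(L_{ab}^c\circ h)S_c$ and the Leibniz rule. A linear $\rho$-connection for $h^*E$ with components $\rho\Gamma_{bc}^a$ has covariant derivative $\rho\ddot D_UV=U^c\big((\rho_c^k\circ h)\frac{\partial V^a}{\partial x^k}+\rho\Gamma_{bc}^aV^b\big)S_a$ for $U,V\in\Gamma(h^*E)$ (components of a linear $\rho$-connection means that this is independent of charts and frames). Its $(\rho,h)$-torsion is $(\rho,h)\mathbb T(U,V)=\rho\ddot D_UV-\rho\ddot D_VU-[U,V]_{h^*E}$. A pseudometrical structure on $h^*E$ is a tensor field $g=g_{ab}S^a\otimes S^b$ whose matrix $\|g_{ab}(x)\|$ is symmetric and nondegenerate for every $x\in M$; it is a metrical structure if moreover the signature is constant; ''(pseudo)metrical'' means either. $\|\tilde g^{ba}(x)\|=\|g_{ab}(x)\|^{-1}$. The connection is compatible with $g$ if $\rho\ddot D_Ug=0$ for all $U\in\Gamma(h^*E)$, i.e. $(\rho_c^k\circ h)\frac{\partial g_{ab}}{\partial x^k}-\rho\Gamma_{ac}^dg_{db}-\rho\Gamma_{bc}^dg_{ad}=0$. A vector bundle is $\rho$-(pseudo)metrizable if it admits a (pseudo)metrical structure and a linear $\rho$-connection compatible with it. *)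

(* Defs.v *)
From mathcomp Require Import all_boot all_order all_algebra.
From mathcomp Require Import all_classical all_reals all_analysis.
Set Implicit Arguments.
Unset Strict Implicit.
Unset Printing Implicit Defensive.
Import Order.TTheory GRing.Theory Num.Theory.
Import numFieldNormedType.Exports.
Local Open Scope classical_set_scope.
Local Open Scope ring_scope.

(** * Smooth maps between normed spaces *)

(* C^k on the set A, used only for open A *)
Fixpoint is_Ck {R : realType} {V W : normedModType R} (k : nat) (A : set V)
    (f : V -> W) : Prop :=
  match k with
  | 0%N => forall x, A x -> {for x, continuous f}
  | k'.+1 => (forall x, A x -> differentiable f x) /\
             (forall v, is_Ck k' A (fun x => 'D_v f x))
  end.

Definition smooth_on {R : realType} {V W : normedModType R} (A : set V)
  (f : V -> W) : Prop := forall k, is_Ck k A f.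

(** * Smooth manifolds of dimension m *)

(* [cinv] is the inverse of [cmap] on [cmap @` cdom]; values of [cmap] outside
   [cdom], and of [cinv] outside that image, are irrelevant. *)
Record chart (R : realType) (m : nat) (M : Type) := Chart {
  cdom : set M;
  cmap : M -> 'rV[R]_m;
  cinv : 'rV[R]_m -> M }.

Definition is_chart {R : realType} {m} {M : topologicalType} (c : chart R m M)
    : Prop :=
  [/\ open (cdom c), open (cmap c @` cdom c),
      forall x, cdom c x -> cinv c (cmap c x) = x,
      forall x, cdom c x -> {for x, continuous (cmap c)} &
      forall x, cdom c x -> {for cmap c x, continuous (cinv c)}].

Definition smooth_transition {R : realType} {m} {M : topologicalType}
    (c d : chart R m M) : Prop :=
  smooth_on (cmap c @` (cdom c `&` cdom d)) (cmap d \o cinv c).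

(* [chart_at x] is a preferred chart around x; it only serves to represent
   tangent vectors at x by their coordinates. *)
Record manifold (R : realType) (m : nat) := Manifold {
  carrier :> topologicalType;
  atlas : set (chart R m carrier);
  chart_at : carrier -> chart R m carrier;
  manifold_hausdorff : hausdorff_space carrier;
  manifold_countable : @second_countable carrier;
  atlas_chart : forall c, atlas c -> is_chart c;
  atlas_smooth : forall c d, atlas c -> atlas d -> smooth_transition c d;
  chart_at_atlas : forall x, atlas (chart_at x);
  chart_at_dom : forall x, cdom (chart_at x) x }.

(* members of the maximal atlas *)
Definition coordinates {R : realType} {m} {M : manifold R m}
    (c : chart R m M) : Prop :=
  is_chart c /\ forall d, atlas d -> smooth_transition c d /\ smooth_transition d c.

Definition smooth_fun_on {R : realType} {m} {M : manifold R m} (A : set M)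
    (f : M -> R) : Prop :=
  forall c, atlas c -> smooth_on (cmap c @` (cdom c `&` A)) (f \o cinv c).

Definition smooth_fun {R : realType} {m} {M : manifold R m} (f : M -> R) :=
  smooth_fun_on setT f.

Definition smooth_map {R : realType} {m} {M : manifold R m} (h : M -> M)
    : Prop :=
  continuous h /\ forall c d, atlas c -> atlas d ->
    smooth_on (cmap c @` (cdom c `&` h @^-1` cdom d)) (cmap d \o h \o cinv c).

Definition diffeomorphism {R : realType} {m} {M : manifold R m}
    (h hinv : M -> M) : Prop :=
  [/\ cancel h hinv, cancel hinv h, smooth_map h & smooth_map hinv].

(* the partial derivative of f along the i-th coordinate of c, at x *)
Definition pderiv {R : realType} {m} {M : manifold R m} (c : chart R m M)
    (i : 'I_m) (f : M -> R) (x : M) : R :=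
  'D_(delta_mx 0 i : 'rV[R]_m) (f \o cinv c) (cmap c x).

(** * Vector bundles of rank r *)

Record frame (R : realType) (M : Type) (r : nat) (F : M -> vectType R) := Frame {
  fdom : set M;
  fvec :> forall x, r.-tuple (F x) }.

(* A family of fibres with a collection of local trivialisations, given by the
   corresponding local frames; the axioms are in [vector_bundle]. *)
Record prebundle (R : realType) (m : nat) (M : manifold R m) (r : nat) :=
  Prebundle {
  fibre :> M -> vectType R;
  trivs : set (frame r fibre) }.

Definition section {R : realType} {m} {M : manifold R m} {r}
  (E : prebundle M r) : Type := forall x : M, E x.

Definition smooth_section_on {R : realType} {m} {M : manifold R m} {r}
    (E : prebundle M r) (A : set M) (u : section E) : Prop :=
  forall t, trivs t -> forall a : 'I_r,
    smooth_fun_on (A `&` fdom t) (fun x => coord (t x) a (u x)).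

Definition smooth_section {R : realType} {m} {M : manifold R m} {r}
  (E : prebundle M r) (u : section E) : Prop := smooth_section_on setT u.

(* smooth local frames over open sets *)
Definition local_frame {R : realType} {m} {M : manifold R m} {r}
    (E : prebundle M r) (s : frame r E) : Prop :=
  [/\ open (fdom s),
      forall x, fdom s x -> basis_of fullv (s x) &
      forall a : 'I_r, smooth_section_on (fdom s) (fun x => (s x)`_a : E x)].

Definition vector_bundle {R : realType} {m} {M : manifold R m} {r}
    (E : prebundle M r) : Prop :=
  (forall t, @trivs _ _ _ _ E t -> local_frame t) /\
  (forall x, exists2 t, @trivs _ _ _ _ E t & fdom t x).

(* morphisms covering the identity *)
Definition bundle_morphism {R : realType} {m} {M : manifold R m} {r q}
    (E : prebundle M r) (F : prebundle M q) (phi : forall x, E x -> F x) : Prop :=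
  (forall x a (u v : E x), phi x (a *: u + v) = a *: phi x u + phi x v) /\
  (forall s t, @trivs _ _ _ _ E s -> @trivs _ _ _ _ F t ->
    forall (a : 'I_r) (b : 'I_q),
      smooth_fun_on (fdom s `&` fdom t)
        (fun x => coord (t x) b (phi x (s x)`_a))).

(** * The tangent bundle *)

(* A vector of T_x M is represented by its coordinates in [chart_at x]. *)
Definition coord_frame {R : realType} {m} {M : manifold R m} (c : chart R m M)
    : frame m (fun _ : M => 'rV[R]_m : vectType R) :=
  Frame (cdom c) (fun x =>
    [tuple ('D_(delta_mx 0 i : 'rV[R]_m) (cmap (chart_at x) \o cinv c) (cmap c x)
            : 'rV[R]_m) | i < m]).

Definition tangent_bundle {R : realType} {m} (M : manifold R m)
    : prebundle M m :=
  @Prebundle R m M m (fun _ => 'rV[R]_m : vectType R)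
    [set coord_frame c | c in @atlas R m M].

(* the tangent map T_x h *)
Definition tangent_map {R : realType} {m} {M : manifold R m} (h : M -> M)
    (x : M) (v : tangent_bundle M x) : tangent_bundle M (h x) :=
  'D_(v : 'rV[R]_m) (cmap (chart_at (h x)) \o h \o cinv (chart_at x))
     (cmap (chart_at x) x).

(* the action X f of a vector field on functions *)
Definition vf_act {R : realType} {m} {M : manifold R m}
    (X : section (tangent_bundle M)) (f : M -> R) (x : M) : R :=
  'D_(X x : 'rV[R]_m) (f \o cinv (chart_at x)) (cmap (chart_at x) x).

(** * Generalized Lie algebroids *)

(* [B] is a Lie algebra bracket on the smooth sections satisfying the Leibniz
   rule for the operator [A] (a section acting on functions as a derivation),
   and [A] is a morphism of Lie algebras. *)
Definition lie_structure {R : realType} {m} {M : manifold R m} {r}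
    (E : prebundle M r) (B : section E -> section E -> section E)
    (A : section E -> (M -> R) -> M -> R) : Prop :=
  (forall u v : section E,
      smooth_section u -> smooth_section v -> smooth_section (B u v)) /\
  (forall (k : R) (u v w : section E),
      smooth_section u -> smooth_section v -> smooth_section w -> forall x,
      B (fun y => k *: u y + v y) w x = k *: B u w x + B v w x /\
      B w (fun y => k *: u y + v y) x = k *: B w u x + B w v x) /\
  (forall u v : section E, smooth_section u -> smooth_section v -> forall x,
      B u v x = - B v u x) /\
  (forall u v w : section E, smooth_section u -> smooth_section v -> smooth_section w ->
      forall x, B u (B v w) x + B v (B w u) x + B w (B u v) x = 0) /\
  (forall (u v : section E) (f : M -> R),
      smooth_section u -> smooth_section v -> smooth_fun f ->
      forall x, B u (fun y => f y *: v y) x = f x *: B u v x + A u f x *: v x) /\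
  (forall (u v : section E) (f : M -> R),
      smooth_section u -> smooth_section v -> smooth_fun f ->
      forall x, A (B u v) f x = A u (A v f) x - A v (A u f) x).

(* Gamma(Th o rho, h)(u) : y |-> Th (rho (u (h^-1 y))).  The result lies in the
   fibre over h (h^-1 y) = y; no transport is needed since the fibres of the
   tangent bundle are all represented by 'rV_m. *)
Definition anchor_field {R : realType} {m} {M : manifold R m} {r}
    (E : prebundle M r) (h hinv : M -> M) (rho : forall x, E x -> tangent_bundle M x)
    (u : section E) : section (tangent_bundle M) :=
  fun y => tangent_map h (rho (hinv y) (u (hinv y))).

Definition gen_lie_algebroid {R : realType} {m} {M : manifold R m} {r}
    (E : prebundle M r) (h hinv : M -> M)
    (rho : forall x, E x -> tangent_bundle M x)
    (br : section E -> section E -> section E) : Prop :=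
  [/\ vector_bundle E, diffeomorphism h hinv, bundle_morphism rho &
      lie_structure br (fun u => vf_act (anchor_field h hinv rho u))].

(** ** Local data *)

(* [s_a, s_b] = L_ab^e s_e on the domain of s, where the bracket of local
   sections is computed near each point on global sections extending them *)
Definition bracket_coefs {R : realType} {m} {M : manifold R m} {r}
    (E : prebundle M r) (B : section E -> section E -> section E)
    (s : frame r E) (L : 'I_r -> 'I_r -> 'I_r -> M -> R) : Prop :=
  forall (a b : 'I_r) (u v : section E) (W : set M),
    smooth_section u -> smooth_section v -> open W -> W `<=` fdom s ->
    (forall x, W x -> u x = (s x)`_a /\ v x = (s x)`_b) ->
    forall x, W x -> B u v x = \sum_(e < r) L a b e x *: (s x)`_e.

Definition bracket_coef {R : realType} {m} {M : manifold R m} {r}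
    (E : prebundle M r) (B : section E -> section E -> section E)
    (s : frame r E) : 'I_r -> 'I_r -> 'I_r -> M -> R :=
  xget (fun _ _ _ _ => 0) [set L | bracket_coefs B s L].

(* The identity defining the functions rho_a^i o h on U \cap h^-1(V).  Its left
   side involves u(x) and its right side u(h x); both make sense together
   because the Leibniz rule and antisymmetry force the field
   Gamma(Th o rho, h)(u) to vanish at every y with h^-1 y <> y. *)
Definition anchor_coefs {R : realType} {m} {M : manifold R m} {r}
    (E : prebundle M r) (h hinv : M -> M)
    (rho : forall x, E x -> tangent_bundle M x)
    (c : chart R m M) (s : frame r E) (P : 'I_r -> 'I_m -> M -> R) : Prop :=
  forall (u : section E) (f : M -> R), smooth_section u -> smooth_fun f ->
  forall x, cdom c x -> fdom s (h x) ->
    vf_act (anchor_field h hinv rho u) f (h x) =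
    \sum_(a < r) \sum_(i < m)
      coord (s (h x)) a (u (h x)) * P a i x * pderiv c i (f \o h) x.

Definition anchor_coef {R : realType} {m} {M : manifold R m} {r}
    (E : prebundle M r) (h hinv : M -> M)
    (rho : forall x, E x -> tangent_bundle M x)
    (c : chart R m M) (s : frame r E) : 'I_r -> 'I_m -> M -> R :=
  xget (fun _ _ _ => 0) [set P | anchor_coefs h hinv rho c s P].

(** ** The pull-back bundle and its Lie algebroid structure *)

Definition pullback_frame {R : realType} {M : Type} {r} (F : M -> vectType R)
    (h : M -> M) (s : frame r F) : frame r (F \o h) :=
  @Frame R M r (F \o h) (h @^-1` fdom s) (fun x => s (h x)).

Definition pullback {R : realType} {m} {M : manifold R m} {r}
    (E : prebundle M r) (h : M -> M) : prebundle M r :=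
  @Prebundle R m M r (E \o h) [set pullback_frame h t | t in @trivs _ _ _ _ E].

Definition pullback_anchor {R : realType} {m} {M : manifold R m} {r}
    (E : prebundle M r) (h hinv : M -> M)
    (rho : forall x, E x -> tangent_bundle M x)
    (A : section (pullback E h) -> (M -> R) -> M -> R) : Prop :=
  forall (c : chart R m M) (s : frame r E), coordinates c -> local_frame s ->
  forall (U : section (pullback E h)) (f : M -> R),
  smooth_section U -> smooth_fun f ->
  forall x, cdom c x -> fdom s (h x) ->
    A U f x = \sum_(a < r) \sum_(i < m)
      coord (pullback_frame h s x) a (U x) *
      anchor_coef h hinv rho c s a i x * pderiv c i f x.

Definition pullback_brackets {R : realType} {m} {M : manifold R m} {r}
    (E : prebundle M r) (h hinv : M -> M)
    (rho : forall x, E x -> tangent_bundle M x)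
    (br : section E -> section E -> section E)
    (B : section (pullback E h) -> section (pullback E h) ->
         section (pullback E h)) : Prop :=
  (exists2 A, pullback_anchor hinv rho A & lie_structure B A) /\
  (forall s : frame r E, local_frame s ->
    @bracket_coefs _ _ _ _ (pullback E h) B (pullback_frame h s)
      (fun a b e x => bracket_coef br s a b e (h x))).

(* the bracket of the Lie algebroid h^*E *)
Definition pullback_bracket {R : realType} {m} {M : manifold R m} {r}
    (E : prebundle M r) (h hinv : M -> M)
    (rho : forall x, E x -> tangent_bundle M x)
    (br : section E -> section E -> section E) :
    section (pullback E h) -> section (pullback E h) -> section (pullback E h) :=
  xget ((fun _ _ _ => 0) : {classic section (pullback E h) ->
          section (pullback E h) -> section (pullback E h)})
    [set B | pullback_brackets hinv rho br B].

(** * Linear connections on h^*E *)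

(* G c s a b e are the components Gamma^a_{b e} in the chart c and the frame
   S = s o h; e is the index of the differentiating section. *)
Definition components {R : realType} {m} {M : manifold R m} {r}
    (E : prebundle M r) : Type :=
  chart R m M -> frame r E -> 'I_r -> 'I_r -> 'I_r -> M -> R.

(* The local expressions given by G are independent of the chart and of the
   frame, and define the covariant derivative D. *)
Definition linear_connection {R : realType} {m} {M : manifold R m} {r}
    (E : prebundle M r) (h hinv : M -> M)
    (rho : forall x, E x -> tangent_bundle M x) (G : components E)
    (D : section (pullback E h) -> section (pullback E h) ->
         section (pullback E h)) : Prop :=
  (forall U V : section (pullback E h),
     smooth_section U -> smooth_section V -> smooth_section (D U V)) /\
  (forall (c : chart R m M) (s : frame r E), coordinates c -> local_frame s ->
   forall U V : section (pullback E h), smooth_section U -> smooth_section V ->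
   forall x, cdom c x -> fdom s (h x) ->
   let S := pullback_frame h s in
   D U V x = \sum_(a < r)
     (\sum_(e < r) coord (S x) e (U x) *
       (\sum_(k < m) anchor_coef h hinv rho c s e k x *
                     pderiv c k (fun y => coord (S y) a (V y)) x +
        \sum_(b < r) G c s a b e x * coord (S x) b (V x))) *: (S x)`_a).

Definition torsion {R : realType} {m} {M : manifold R m} {r}
    (E : prebundle M r) (h hinv : M -> M)
    (rho : forall x, E x -> tangent_bundle M x)
    (br : section E -> section E -> section E)
    (D : section (pullback E h) -> section (pullback E h) ->
         section (pullback E h))
    (U V : section (pullback E h)) : section (pullback E h) :=
  fun x => D U V x - D V U x - pullback_bracket hinv rho br U V x.

(** * (Pseudo)metrical structures *)

Definition tensor02 {R : realType} {m} {M : manifold R m} {r}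
  (E : prebundle M r) : Type := forall x, E x -> E x -> R.

Definition tensor_mx {R : realType} {m} {M : manifold R m} {r}
    (E : prebundle M r) (g : tensor02 E) (s : frame r E) (x : M) : 'M[R]_r :=
  \matrix_(a < r, b < r) g x (s x)`_a (s x)`_b.

Definition smooth_tensor {R : realType} {m} {M : manifold R m} {r}
    (E : prebundle M r) (g : tensor02 E) : Prop :=
  (forall x k (u v w : E x), g x (k *: u + v) w = k * g x u w + g x v w /\
                             g x w (k *: u + v) = k * g x w u + g x w v) /\
  (forall t, @trivs _ _ _ _ E t -> forall a b : 'I_r,
     smooth_fun_on (fdom t) (fun x => tensor_mx g t x a b)).

Definition pseudometrical {R : realType} {m} {M : manifold R m} {r}
    (E : prebundle M r) (g : tensor02 E) : Prop :=
  smooth_tensor g /\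
  (forall t x, @trivs _ _ _ _ E t -> fdom t x ->
     (tensor_mx g t x)^T = tensor_mx g t x /\ tensor_mx g t x \in unitmx).

(* constant signature (p, r - p) *)
Definition metrical {R : realType} {m} {M : manifold R m} {r}
    (E : prebundle M r) (g : tensor02 E) : Prop :=
  pseudometrical g /\
  (exists2 p : nat, (p <= r)%N &
    forall t x, @trivs _ _ _ _ E t -> fdom t x ->
    exists2 P : 'M[R]_r, P \in unitmx &
      P *m tensor_mx g t x *m P^T =
      diag_mx (\row_(i < r) (if (i < p)%N then 1 else - 1))).

(* D_U g = 0 for all U, in components *)
Definition compatible {R : realType} {m} {M : manifold R m} {r}
    (E : prebundle M r) (h hinv : M -> M)
    (rho : forall x, E x -> tangent_bundle M x) (G : components E)
    (g : tensor02 (pullback E h)) : Prop :=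
  forall (c : chart R m M) (s : frame r E), coordinates c -> local_frame s ->
  forall U : section (pullback E h), smooth_section U ->
  forall x, cdom c x -> fdom s (h x) -> forall a b : 'I_r,
  let S := pullback_frame h s in
  let gS := tensor_mx g S in
  \sum_(e < r) coord (S x) e (U x) *
    (\sum_(k < m) anchor_coef h hinv rho c s e k x *
                  pderiv c k (fun y => gS y a b) x
     - \sum_(d < r) G c s d a e x * gS x d b
     - \sum_(d < r) G c s d b e x * gS x a d) = 0.

Definition pseudometrizable {R : realType} {m} {M : manifold R m} {r}
    (E : prebundle M r) (h hinv : M -> M)
    (rho : forall x, E x -> tangent_bundle M x) : Prop :=
  exists (g : tensor02 (pullback E h)) (G : components E)
    (D : section (pullback E h) -> section (pullback E h) ->
         section (pullback E h)),
    [/\ pseudometrical g, linear_connection hinv rho G D &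
        compatible hinv rho G g].

Definition metrizable {R : realType} {m} {M : manifold R m} {r}
    (E : prebundle M r) (h hinv : M -> M)
    (rho : forall x, E x -> tangent_bundle M x) : Prop :=
  exists (g : tensor02 (pullback E h)) (G : components E)
    (D : section (pullback E h) -> section (pullback E h) ->
         section (pullback E h)),
    [/\ metrical g, linear_connection hinv rho G D & compatible hinv rho G g].

(* The Christoffel-type expression at x, for anchor components P, bracket
   coefficients L and metric matrix gS in the chart c:
   1/2 g~^{ad} (P_e^k d_k g_bd + P_b^j d_j g_de - P_d^l d_l g_be
                - L_be^f g_fd - L_bd^f g_fe + L_de^f g_fb) *)
Definition christoffel {R : realType} {m} {M : manifold R m} {r}
    (c : chart R m M) (P : 'I_r -> 'I_m -> M -> R)
    (L : 'I_r -> 'I_r -> 'I_r -> M -> R) (gS : M -> 'M[R]_r)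
    (a b e : 'I_r) (x : M) : R :=
  2^-1 * \sum_(d < r) invmx (gS x) a d *
    (\sum_(k < m) P e k x * pderiv c k (fun y => gS y b d) x
     + \sum_(j < m) P b j x * pderiv c j (fun y => gS y d e) x
     - \sum_(l < m) P d l x * pderiv c l (fun y => gS y b e) x
     - \sum_(f < r) L b e f x * gS x f d
     - \sum_(f < r) L b d f x * gS x f e
     + \sum_(f < r) L d e f x * gS x f b).

Definition rho_christoffel {R : realType} {m} {M : manifold R m} {r}
    (E : prebundle M r) (h hinv : M -> M)
    (rho : forall x, E x -> tangent_bundle M x)
    (br : section E -> section E -> section E)
    (g : tensor02 (pullback E h)) : components E :=
  fun c s => christoffel c (anchor_coef h hinv rho c s)
    (fun a b e x => bracket_coef br s a b e (h x))
    (tensor_mx g (pullback_frame h s)).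

(* rho(s_a) = rho_a^i d/dx^i *)
Definition morphism_coef {R : realType} {m} {M : manifold R m} {r}
    (E : prebundle M r) (rho : forall x, E x -> tangent_bundle M x)
    (c : chart R m M) (s : frame r E) (a : 'I_r) (i : 'I_m) (x : M) : R :=
  coord (coord_frame c x) i (rho x (s x)`_a : 'rV[R]_m).

(* Main.v *)
(* The Christoffel-type formula is the frame expression of the Koszul functional
     K(u, v, w) = A_u g(v, w) + A_v g(w, u) - A_w g(u, v)
                  + g([u, v], w) - g([u, w], v) - g([v, w], u)
   of the Lie algebroid h^*E.  K is linear over functions in u and w, and
   K(u, f v, w) = f K(u, v, w) + 2 (A_u f) g(v, w), so 2 g(D_u v, w) = K(u, v, w)
   defines D independently of charts and frames; vanishing torsion and D g = 0
   are the identities K(u, v, w) - K(v, u, w) = 2 g([u, v], w) and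
   K(u, v, w) + K(u, w, v) = 2 A_u g(v, w).
   The functions rho_a^i o h exist because the field Gamma(Th o rho, h)(u)
   vanishes at the points moved by h, and the Lie algebroid h^*E is the transport
   of E along the diffeomorphism h. *)

Require Import Defs.
From mathcomp Require Import all_boot all_order all_algebra.
From mathcomp Require Import all_classical all_reals all_analysis.
From mathcomp Require Import ring lra.
Import Order.TTheory GRing.Theory Num.Theory.
Import numFieldNormedType.Exports.
Set Implicit Arguments.
Unset Strict Implicit.
Unset Printing Implicit Defensive.
Local Open Scope classical_set_scope.
Local Open Scope ring_scope.

(** * Maps of class C^k *)

(** Brackets, anchors and covariant derivatives act on global sections and global functions, whereas
    the formula lives in a local frame. Every local computation therefore goes through frames and
    coordinates cut off by a bump function, which is where the calculus of C^k maps and the flat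
    function are used. A second constraint comes from [anchor_coef], [bracket_coef] and
    [pullback_bracket]: they are chosen by specification, so some object meeting the specification
    has to be exhibited, and afterwards nothing but the specification is available. In particular
    the anchor of the pull-back is only known as some operator A attached to the chosen bracket. The
    Koszul argument is therefore carried out for an abstract pair (B, A) such that A has a local
    expression at each point. One frame around each point suffices for the existence of the
    connection; its expression in every other chart and frame then follows from uniqueness, without
    any transformation law for the components. *)

Section Ck.
Context {R : realType} {V W : normedModType R}.
Implicit Types (A B : set V) (k : nat).

(** The difference g - f vanishes near x, so it is differentiable there with differential 0, and g
    is the sum of f and this difference. *)
Lemma near_eq_differentiable (f g : V -> W) (x : V) :
  {near x, f =1 g} -> differentiable f x -> differentiable g x.
Proof.
move=> fg df.
have e0 : \forall y \near (0 : V), (g - f) (y + x) = 0.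
  have : \forall y \near x, (g - f) y = 0.
    near=> y; apply/eqP; rewrite subr_eq0; apply/eqP/esym.
    by near: y.
  by rewrite (near_shift 0) /= subr0.
suff de : differentiable (g - f) x.
  by have := differentiableD df de; rewrite addrC subrK.
apply/diff_locallyP.
have ez : (g - f) \o shift x = cst ((g - f) x) + \0 +o_ (0:V) id.
  apply/eqaddoP => _/posnumP[eps]; near=> y.
  have -> : ((g - f) \o shift x - (cst ((g - f) x) + \0)) y = 0.
    transitivity ((g - f) (y + x) - ((g - f) x + 0)) => //.
    rewrite (near e0 y)// -[X in (g - f) X]add0r.
    by rewrite (nbhs_singleton e0) addr0 subrr.
  by rewrite normr0 mulr_ge0.
have c0 : continuous (\0 : V -> W) by move=> y; exact: cst_continuous.
by rewrite (diff_unique c0 ez); split.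
Unshelve. all: by end_near. Qed.

Lemma is_Ck_subset k A B (f : V -> W) : A `<=` B -> is_Ck k B f -> is_Ck k A f.
Proof.
move=> AB; elim: k f => [f h x /AB /h //|k IH f [h1 h2]]; split.
  by move=> x /AB /h1.
by move=> v; apply: IH; exact: h2.
Qed.

Lemma is_Ck_eq k A (f g : V -> W) : open A -> (forall x, A x -> f x = g x) ->
  is_Ck k A f -> is_Ck k A g.
Proof.
move=> oA; elim: k f g => [|k IH] f g fg.
  move=> h x Ax; have nfg : {near x, f =1 g}.
    by near do apply: fg; exact: open_nbhs_nbhs.
  have := h x Ax; rewrite /prop_for /continuous_at (nbhs_singleton nfg).
  by apply: cvg_trans; apply: near_eq_cvg.
move=> [h1 h2]; split.
  move=> x Ax; apply: near_eq_differentiable (h1 x Ax).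
  by near do apply: fg; exact: open_nbhs_nbhs.
move=> v; apply: IH (h2 v) => x Ax; apply: near_eq_derive.
by near do apply: fg; exact: open_nbhs_nbhs.
Unshelve. all: by end_near. Qed.

Lemma is_CkW k A (f : V -> W) : is_Ck k.+1 A f -> is_Ck k A f.
Proof.
elim: k f => [f [h _] x /h /differentiable_continuous //|k IH f [h1 h2]].
by split => // v; apply: IH; exact: h2.
Qed.

Lemma is_Ck_local k A (f : V -> W) :
  (forall x, A x -> exists2 B, open_nbhs x B & is_Ck k B f) -> is_Ck k A f.
Proof.
elim: k f => [|k IH] f h.
  by move=> x /h[B [_ Bx]]; exact.
split.
  by move=> x /h[B [_ Bx] [d _]]; exact: d.
by move=> v; apply: IH => x /h[B oB [_ d]]; exists B => //; exact: d.
Qed.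

Lemma is_Ck_cst k A (a : W) : is_Ck k A (cst a).
Proof.
elim: k a => [a x _|k IH a]; first exact: cst_continuous.
split => // v; have -> : (fun x => 'D_v (cst a) x) = cst (0 : W).
  by apply/funext => x; rewrite derive_cst.
exact: IH.
Qed.

Lemma is_CkD k A (f g : V -> W) : open A ->
  is_Ck k A f -> is_Ck k A g -> is_Ck k A (f + g).
Proof.
move=> oA; elim: k f g => [f g hf hg x Ax|k IH f g [f1 f2] [g1 g2]].
  by apply: continuousD; [exact: hf|exact: hg].
split => [x Ax|v]; first by apply: differentiableD; [exact: f1|exact: g1].
apply: is_Ck_eq (IH _ _ (f2 v) (g2 v)) => // x Ax.
by rewrite deriveD //; apply: diff_derivable; [exact: f1|exact: g1].
Qed.

Lemma is_Ck_sum k A (I : Type) (s : seq I) (f : I -> V -> W) : open A ->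
  (forall i, is_Ck k A (f i)) -> is_Ck k A (fun x => \sum_(i <- s) f i x).
Proof.
move=> oA hf; elim: s => [|i s IH].
  by under eq_fun do rewrite big_nil; exact: is_Ck_cst.
by under eq_fun do rewrite big_cons; exact: is_CkD.
Qed.

Lemma is_CkN k A (f : V -> W) : open A -> is_Ck k A f -> is_Ck k A (- f).
Proof.
move=> oA; elim: k f => [f hf x Ax|k IH f [f1 f2]].
  by apply: continuousN; exact: hf.
split => [x Ax|v]; first by apply: differentiableN; exact: f1.
apply: is_Ck_eq (IH _ (f2 v)) => // x Ax.
by rewrite deriveN //; apply: diff_derivable; exact: f1.
Qed.

End Ck.

(** * Products, inverses and composition of C^k maps *)

Section CkR.
Context {R : realType} {V : normedModType R}.
Implicit Types (A : set V) (k : nat).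

Lemma is_CkM k A (f g : V -> R) : open A ->
  is_Ck k A f -> is_Ck k A g -> is_Ck k A (f * g).
Proof.
move=> oA; elim: k f g => [f g hf hg x Ax|k IH f g hf hg].
  by apply: continuousM; [exact: hf|exact: hg].
have [[f1 f2] [g1 g2]] := (hf, hg).
split => [x Ax|v]; first by apply: differentiableM; [exact: f1|exact: g1].
apply: (@is_Ck_eq _ _ _ k A (f * (fun x => 'D_v g x) + g * (fun x => 'D_v f x))) => //.
  move=> x Ax; have df : derivable f x v by apply: diff_derivable; exact: f1.
  have dg : derivable g x v by apply: diff_derivable; exact: g1.
  by have -> := deriveM df dg; rewrite [LHS]/(f x * 'D_v g x + g x * 'D_v f x).
apply: is_CkD => //; apply: IH; [exact: is_CkW|exact: g2|exact: is_CkW|exact: f2].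
Qed.

Lemma is_CkV k A (f : V -> R) : open A -> (forall x, A x -> f x != 0) ->
  is_Ck k A f -> is_Ck k A (fun x => (f x)^-1).
Proof.
move=> oA f0; elim: k => [hf x Ax|k IH hf].
  by apply: cvgV; [exact: f0|exact: hf].
have [f1 f2] := hf.
split => [x Ax|v]; first by apply: differentiableV; [exact: f1|exact: f0].
pose g := fun x => (f x)^-1.
apply: (@is_Ck_eq _ _ _ k A (- (g * g * (fun x => 'D_v f x)))) => //.
  move=> x Ax; rewrite deriveV; [|exact: f0|by apply: diff_derivable; exact: f1].
  rewrite [LHS]/(- (g x * g x * 'D_v f x)) /g -[RHS]/((- f x ^- 2) * 'D_v f x).
  by rewrite -exprVn expr2 mulNr.
apply: is_CkN => //; apply: is_CkM => //; last exact: f2.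
by apply: is_CkM => //; apply: IH; exact: is_CkW.
Qed.

Lemma is_Ck_prod k A (I : Type) (s : seq I) (f : I -> V -> R) : open A ->
  (forall i, is_Ck k A (f i)) -> is_Ck k A (fun x => \prod_(i <- s) f i x).
Proof.
move=> oA hf; elim: s => [|i s IH].
  by under eq_fun do rewrite big_nil; exact: is_Ck_cst.
by under eq_fun do rewrite big_cons; exact: is_CkM.
Qed.

Lemma is_Ck_coord n k A (f : V -> 'rV[R]_n) (i : 'I_n) : open A ->
  is_Ck k A f -> is_Ck k A (fun x => f x 0 i).
Proof.
move=> oA; elim: k f => [f hf x Ax|k IH f [f1 f2]].
  apply: (@continuous_comp _ _ _ f (fun M : 'rV[R]_n => M 0 i)); first exact: hf.
  exact: coord_continuous.
split => [x Ax|v].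
  apply: (@differentiable_comp _ _ _ _ f (fun M : 'rV[R]_n => M 0 i)).
    exact: f1.
  exact: differentiable_coord.
apply: is_Ck_eq (IH _ (f2 v)) => // x Ax.
by rewrite derive_mx ?mxE //; apply: diff_derivable; exact: f1.
Qed.

Lemma derive_rV_sum n (W : normedModType R) (g : 'rV[R]_n -> W) a v :
  differentiable g a ->
  'D_v g a = \sum_(i < n) v 0 i *: 'D_(delta_mx 0 i) g a.
Proof.
move=> dg; rewrite deriveE // {1}[v]row_sum_delta linear_sum.
by apply: eq_bigr => i _; rewrite linearZ /= deriveE.
Qed.

Lemma derive_comp_rV n (W : normedModType R) (f : V -> 'rV[R]_n)
    (g : 'rV[R]_n -> W) x v :
  differentiable f x -> differentiable g (f x) ->
  'D_v (g \o f) x = \sum_(i < n) 'D_v f x 0 i *: 'D_(delta_mx 0 i) g (f x).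
Proof.
move=> df dg; rewrite deriveE; last exact: differentiable_comp.
by rewrite diff_comp //= -derive_rV_sum // !deriveE.
Qed.

(** The derivative of g \o f along v is that of g in the direction 'D_v f x, which varies with x,
    while [is_Ck] iterates derivatives along fixed directions. Expanding the direction in the
    canonical basis turns it into a sum of products of C^k functions. *)
Lemma is_Ck_comp n k A (B : set 'rV[R]_n) (f : V -> 'rV[R]_n)
    (g : 'rV[R]_n -> R) : open A -> (forall x, A x -> B (f x)) ->
  is_Ck k A f -> is_Ck k B g -> is_Ck k A (g \o f).
Proof.
move=> oA AB; elim: k g => [|k IH] g.
  by move=> hf hg x Ax; apply: continuous_comp; [exact: hf|apply: hg; exact: AB].
move=> hf [g1 g2]; have [f1 f2] := hf; split => [x Ax|v].
  by apply: differentiable_comp; [exact: f1|apply: g1; exact: AB].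
apply: (@is_Ck_eq _ _ _ k A (fun x => \sum_(i < n)
   ((fun x => 'D_v f x 0 i) * ((fun y => 'D_(delta_mx 0 i) g y) \o f)) x)) => //.
  move=> x Ax; rewrite derive_comp_rV //; [exact: f1|apply: g1; exact: AB].
apply: is_Ck_sum => // i; apply: is_CkM => //.
  exact: is_Ck_coord (f2 v).
by apply: IH => //; [exact: is_CkW|exact: g2].
Qed.

End CkR.

(** * Flat functions and bump functions on R^n *)

Section Flat.
Context {R : realType}.

(* The span of these functions is closed under derivation, see [flat_derive]. *)
Definition flat (n : nat) (t : R) : R :=
  if 0 < t then t ^- n * expR (- t^-1) else 0.

Lemma flat_gt0 n t : 0 < t -> 0 < flat n t.
Proof. by move=> t0; rewrite /flat t0 mulr_gt0 ?expR_gt0 // invr_gt0 exprn_gt0. Qed.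

Lemma flat_eq0 n t : t <= 0 -> flat n t = 0.
Proof. by move=> t0; rewrite /flat ltNge t0. Qed.

Lemma flat_ge0 n t : 0 <= flat n t.
Proof.
by have [t0|t0] := ltP 0 t; [exact/ltW/flat_gt0|rewrite flat_eq0].
Qed.

Lemma flatS n t : flat n t = t * flat n.+1 t.
Proof.
rewrite /flat; case: ifP => [t0|_]; last by rewrite mulr0.
by rewrite mulrA exprS invfM mulrA divff ?mul1r // gt_eqF.
Qed.

(** For t > 0 the term of degree n + 1 of the exponential series bounds expR t^-1 from below by
    t^-(n+1) / (n+1)!. The remaining factor t gives continuity at 0. *)
Lemma flat_le n t : flat n t <= n.+1`!%:R * `|t|.
Proof.
have [t0|t0] := ltP 0 t; last by rewrite flat_eq0 ?mulr_ge0.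
rewrite (gtr0_norm t0) /flat t0.
have := @expR_ge1Dxn _ t^-1 n (ltW _); rewrite invr_gt0 => /(_ t0) h.
have {}h : (t^-1) ^+ n.+1 / n.+1`!%:R <= expR t^-1.
  by apply: le_trans h; rewrite lerDr.
have fp : 0 < n.+1`!%:R :> R by rewrite ltr0n fact_gt0.
rewrite expRN ler_pdivrMr ?expR_gt0 // -exprVn.
rewrite ler_pdivrMr // in h.
have -> : t^-1 ^+ n = t * t^-1 ^+ n.+1.
  by rewrite exprS mulrA divff ?mul1r // gt_eqF.
by rewrite mulrAC mulrC ler_wpM2r ?(ltW t0) // mulrC.
Qed.

Lemma flat_cont0 n : flat n x @[x --> (0:R)] --> (0:R).
Proof.
apply: (@squeeze_cvgr _ _ _ _ (cst 0) (fun x => n.+1`!%:R * `|x|)).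
- by near=> x; rewrite flat_ge0 flat_le.
- exact: cvg_cst.
- rewrite -[X in _ --> X](mulr0 n.+1`!%:R); apply: cvgMr; last first.
  rewrite -[X in _ --> X](@normr0 _ R); apply: cvg_norm; exact: cvg_id.
Unshelve. all: by end_near. Qed.

Lemma flat_derive n t :
  is_derive t (1 : R) (flat n) (flat n.+2 t - n%:R * flat n.+1 t).
Proof.
have [t0|t0|->] := ltgtP t 0.
- rewrite !flat_eq0 ?(ltW t0) // mulr0 subr0.
  apply: near_eq_is_derive (is_derive_cst 0 t 1).
  near=> s; rewrite flat_eq0 //; apply: ltW; near: s; exact: lt_nbhsl.
- apply: (@near_eq_is_derive _ _ _ (fun s : R => (s^-1) ^+ n * expR (- s^-1) : R)).
    near=> s; rewrite /flat ifT ?exprVn //; near: s; exact: lt_nbhsr.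
  have dV : is_derive t (1 : R) (fun s : R => s^-1 : R) (- t ^- 2).
    have := @is_deriveV R id t 1 1; rewrite gt_eqF // => /(_ isT) h.
    by apply: is_derive_eq; rewrite /GRing.scale /= mulr1.
  have dE : is_derive t (1 : R) (fun s : R => expR (- s^-1) : R) (t ^- 2 * expR (- t^-1)).
    have hE := is_derive_expR (- t^-1).
    have hN := is_deriveN dV.
    have := @is_derive1_comp R expR (- (fun s : R => s^-1 : R)) t _ _ hE hN.
    by rewrite opprK mulrC; congr is_derive.
  have dX := is_deriveX n dV.
  have expE s j : ((fun s : R => s^-1 : R) ^+ j) s = s^-1 ^+ j.
    by elim: j => // j IH; rewrite [RHS]exprS -IH exprS.
  have := is_deriveM dX dE.
  rewrite (_ : GRing.exp _ n * _ = fun s : R => s^-1 ^+ n * expR (- s^-1) : R); last first.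
    by apply/funext => s; rewrite [LHS]/(((fun s : R => s^-1 : R) ^+ n) s * _) expE.
  move=> [hd hv]; split; first exact: hd.
  rewrite hv /flat t0 /GRing.scale /= expE.
  have tn0 : t != 0 by rewrite gt_eqF.
  case: n {dX hd hv} => [|n] /=.
    by field.
  rewrite !exprS exprVn; field.
  by rewrite expf_neq0.
(* By [flatS] the difference quotient of [flat n] at 0 is [flat n.+1], which is continuous at 0 with
   value 0. *)
- apply/is_derive1_caratheodory; exists (flat n.+1); split.
  + by move=> z; rewrite subr0 [flat n 0]flat_eq0 // subr0 mulrC -flatS.
  + by rewrite /prop_for /continuous_at (flat_eq0 n.+1 (lexx 0)); exact: flat_cont0.
  + by rewrite !flat_eq0 // mulr0 subr0.
Unshelve. all: by end_near. Qed.

(** The induction on k has to cover all n at once, since differentiating raises n by 1 and by 2. *)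
Lemma is_Ck_flat (V : normedModType R) k n (A : set V) (l : V -> R) : open A ->
  is_Ck k A l -> is_Ck k A (flat n \o l).
Proof.
move=> oA; have dff j t : differentiable (flat j) t.
  by apply/derivable1_diffP; have [] := flat_derive j t.
elim: k n => [|k IH] n hl.
  move=> x Ax; apply: continuous_comp; first exact: hl.
  exact: differentiable_continuous.
have [l1 l2] := hl; split => [x Ax|v].
  by apply: differentiable_comp => //; exact: l1.
apply: (@is_Ck_eq _ _ _ k A
   ((fun x => 'D_v l x) * ((flat n.+2 \o l) + - (cst n%:R * (flat n.+1 \o l))))) => //.
  move=> x Ax; rewrite deriveE; last by apply: differentiable_comp => //; exact: l1.
  rewrite diff_comp //=; last exact: l1.
  rewrite -(deriveE v (l1 x Ax)) -[X in 'd (flat n) _ X]mulr1.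
  rewrite -[X in 'd (flat n) _ X]/('D_v l x *: (1 : R)) [RHS]linearZ /= -deriveE //.
  by have [_ ->] := flat_derive n (l x).
apply: is_CkM => //; first exact: l2.
apply: is_CkD => //; first by apply: IH => //; exact: is_CkW.
apply: is_CkN => //; apply: is_CkM => //; first exact: is_Ck_cst.
by apply: IH => //; exact: is_CkW.
Qed.

(** The classical smooth transition between the values 1 and 0. As 2 - t and t - 1 add up to 1, one
    of them is positive and the denominator never vanishes. *)
Definition step (t : R) : R := flat 0 (2 - t) / (flat 0 (2 - t) + flat 0 (t - 1)).

Lemma step_den t : 0 < flat 0 (2 - t) + flat 0 (t - 1).
Proof.
have [t1|t1] := ltP t 2.
  by rewrite ltr_wpDr ?flat_ge0 // flat_gt0 // subr_gt0.
rewrite ltr_wpDl ?flat_ge0 // flat_gt0 // subr_gt0; apply: lt_le_trans t1.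
by rewrite ltr1n.
Qed.

Lemma step_le1 t : t <= 1 -> step t = 1.
Proof.
move=> t1; rewrite /step; have := step_den t.
rewrite [flat 0 (t - 1)]flat_eq0 ?subr_le0 // addr0 => h.
by rewrite divff // gt_eqF.
Qed.

Lemma step_ge2 t : 2 <= t -> step t = 0.
Proof. by move=> t2; rewrite /step [flat 0 (2 - t)]flat_eq0 ?subr_le0 // mul0r. Qed.

Lemma is_Ck_step (V : normedModType R) k (A : set V) (l : V -> R) : open A ->
  is_Ck k A l -> is_Ck k A (step \o l).
Proof.
move=> oA hl.
have h1 : is_Ck k A (flat 0 \o (cst 2 + - l)).
  by apply: is_Ck_flat => //; apply: is_CkD => //; [exact: is_Ck_cst|exact: is_CkN].
have h2 : is_Ck k A (flat 0 \o (l + - cst 1)).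
  by apply: is_Ck_flat => //; apply: is_CkD => //; apply: is_CkN => //; exact: is_Ck_cst.
apply: (@is_Ck_eq _ _ _ k A ((flat 0 \o (cst 2 + - l)) *
  (fun x => (((flat 0 \o (cst 2 + - l)) + (flat 0 \o (l + - cst 1))) x)^-1))) => //.
apply: is_CkM => //; apply: is_CkV => //; last exact: is_CkD.
by move=> x Ax; rewrite gt_eqF //; exact: step_den.
Qed.

Lemma is_Ck_id_coord n k (A : set 'rV[R]_n) (i : 'I_n) : open A ->
  is_Ck k A (fun x => x 0 i).
Proof.
move=> oA; apply: (@is_Ck_coord _ _ _ _ _ id) => //.
case: k => [x _|k]; first exact: cvg_id.
split => // v; apply: (@is_Ck_eq _ _ _ k A (cst v)) => //; last exact: is_Ck_cst.
by move=> x _; rewrite derive_id.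
Qed.

(** Neither the maximum norm nor the absolute value is smooth, so each coordinate is cut off on its
    two sides separately, by [step] at (x_i - p_i) / e and at its opposite; the thresholds e and 2 e
    are the thresholds 1 and 2 of [step]. *)
Lemma cube_bump n (p : 'rV[R]_n) (e : R) : 0 < e -> exists b : 'rV[R]_n -> R,
  [/\ smooth_on setT b,
      forall x : 'rV[R]_n, (forall i, `|x 0 i - p 0 i| <= e) -> b x = 1 &
      forall (x : 'rV[R]_n) i, 2 * e <= `|x 0 i - p 0 i| -> b x = 0].
Proof.
move=> e0; pose l i := (cst e^-1 * ((fun x : 'rV[R]_n => x 0 i) + - cst (p 0 i))).
exists (fun x => \prod_(i < n) (step (l i x) * step ((- l i) x))); split.
- move=> k; apply: is_Ck_prod => [|i]; first exact: openT.
  have hl : is_Ck k setT (l i).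
    apply: is_CkM; [exact: openT|exact: is_Ck_cst|].
    apply: is_CkD; [exact: openT|exact/is_Ck_id_coord/openT|].
    by apply: is_CkN; [exact: openT|exact: is_Ck_cst].
  apply: (@is_CkM _ _ k setT (step \o l i) (step \o (- l i))); first exact: openT.
    by apply: is_Ck_step => //; exact: openT.
  by apply: is_Ck_step; [exact: openT|apply: is_CkN => //; exact: openT].
- move=> x hx; apply: big1 => i _.
  rewrite [l i x]/(e^-1 * (x 0 i - p 0 i)) [(- l i) x]/(- (e^-1 * (x 0 i - p 0 i))).
  have := hx i; rewrite ler_norml => /andP[h1 h2].
  have s1 : step (e^-1 * (x 0 i - p 0 i)) = 1.
    by apply: step_le1; rewrite mulrC ler_pdivrMr // mul1r.
  have s2 : step (- (e^-1 * (x 0 i - p 0 i))) = 1.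
    by apply: step_le1; rewrite lerNl mulrC ler_pdivlMr // mulN1r.
  by rewrite s1 s2 mulr1.
- move=> x i hx; rewrite (bigD1 i) //= [X in X * _ = _](_ : _ = 0) ?mul0r //.
  rewrite [l i x]/(e^-1 * (x 0 i - p 0 i)) [(- l i) x]/(- (e^-1 * (x 0 i - p 0 i))).
  move: hx; rewrite ler_normr => /orP[] hx.
    have -> : step (e^-1 * (x 0 i - p 0 i)) = 0.
      by apply: step_ge2; rewrite mulrC ler_pdivlMr.
    by rewrite mul0r.
  have -> : step (- (e^-1 * (x 0 i - p 0 i))) = 0.
    by apply: step_ge2; rewrite -mulrN mulrC ler_pdivlMr.
  by rewrite mulr0.
Qed.

End Flat.

(** * Smooth functions on a manifold *)

Section SmoothFun.
Context {R : realType} {m : nat} {M : manifold R m}.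
Implicit Types (A B O : set M) (c d : chart R m M) (f g : M -> R).

(** Inside the open image of the chart, the image of A is the preimage of A under [cinv c], which is
    continuous there. *)
Lemma chart_open c A : is_chart c -> open A -> open (cmap c @` (cdom c `&` A)).
Proof.
move=> [od oc cK cc ci] oA; rewrite openE => _ [x [cx Ax] <-].
have h1 : nbhs (cmap c x) (cinv c @^-1` (cdom c `&` A)).
  by apply: (ci x cx); rewrite cK //; apply: open_nbhs_nbhs; split => //; exact: openI.
have h2 : nbhs (cmap c x) (cmap c @` cdom c).
  by apply: open_nbhs_nbhs; split => //; exists x.
rewrite /interior; near=> y.
have [z cz zy] : (cmap c @` cdom c) y by near: y.
have : (cinv c @^-1` (cdom c `&` A)) y by near: y.
by rewrite -zy /= cK // => -[_ Az]; exists z.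
Unshelve. all: by end_near. Qed.

Lemma near_cinv c x (P : set M) : is_chart c -> cdom c x -> nbhs x P ->
  \forall y \near cmap c x, P (cinv c y).
Proof. by move=> [od oc cK cc ci] cx Px; apply: (ci x cx); rewrite cK. Qed.

Lemma atlas_coordinates c : atlas c -> coordinates c.
Proof.
move=> ac; split; first exact: atlas_chart.
by move=> d ad; split; apply: atlas_smooth.
Qed.

Lemma chart_at_coordinates (x : M) : coordinates (chart_at x).
Proof. by apply: atlas_coordinates; exact: chart_at_atlas. Qed.

Lemma smooth_change c d A f : is_chart c -> is_chart d -> smooth_transition c d ->
  open A -> smooth_on (cmap d @` (cdom d `&` A)) (f \o cinv d) ->
  smooth_on (cmap c @` (cdom c `&` (cdom d `&` A))) (f \o cinv c).
Proof.
move=> hc hd t oA hf k.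
have oB : open (cmap c @` (cdom c `&` (cdom d `&` A))).
  by apply: chart_open => //; apply: openI => //; have [] := hd.
have cK : forall x, cdom c x -> cinv c (cmap c x) = x by have [] := hc.
have dK : forall x, cdom d x -> cinv d (cmap d x) = x by have [] := hd.
apply: (@is_Ck_eq _ _ _ k _ ((f \o cinv d) \o (cmap d \o cinv c))) => //.
  by move=> _ [x [cx [dx Ax]] <-] /=; rewrite cK // dK.
apply: (@is_Ck_comp _ _ _ k _ _ _ _ oB _ _ (hf k)).
  by move=> _ [x [cx [dx Ax]] <-] /=; rewrite cK //; exists x.
apply: is_Ck_subset (t k) => _ [x [cx [dx Ax]] <-] /=; by exists x.
Qed.

(** Smoothness is defined with the charts of the atlas; this carries it to the maximal atlas, around
    each point through the preferred chart. *)
Lemma smooth_on_chart c A f : coordinates c -> open A -> smooth_fun_on A f ->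
  smooth_on (cmap c @` (cdom c `&` A)) (f \o cinv c).
Proof.
move=> [hc tc] oA hf k; apply: is_Ck_local => _ [x [cx Ax] <-].
pose d := chart_at x; have ad : atlas d by exact: chart_at_atlas.
exists (cmap c @` (cdom c `&` (cdom d `&` A))).
  split; last by exists x => //; split => //; split => //; exact: chart_at_dom.
  by apply: chart_open => //; apply: openI => //; have [] := atlas_chart ad.
apply: smooth_change => //; [exact: atlas_chart|exact: (tc d ad).1|exact: hf].
Qed.

Lemma chart_smooth_on c A f : coordinates c -> open A -> A `<=` cdom c ->
  smooth_on (cmap c @` (cdom c `&` A)) (f \o cinv c) -> smooth_fun_on A f.
Proof.
move=> [hc tc] oA Ac hf d ad k.
have -> : cdom d `&` A = cdom d `&` (cdom c `&` A).
  by congr setI; apply/seteqP; split => [x Ax|x []//]; split => //; exact: Ac.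
apply: smooth_change => //; [exact: atlas_chart|exact: (tc d ad).2].
Qed.

Lemma smooth_fun_on_local A f :
  (forall x, A x -> exists2 B, open_nbhs x B & smooth_fun_on B f) ->
  smooth_fun_on A f.
Proof.
move=> h c ac k; apply: is_Ck_local => _ [x [cx Ax] <-].
have [B [oB Bx] hB] := h x Ax.
exists (cmap c @` (cdom c `&` B)); last exact: hB.
by split; [apply: chart_open => //; exact: atlas_chart|exists x].
Qed.

Lemma smooth_fun_on_eq A f g : open A -> (forall x, A x -> f x = g x) ->
  smooth_fun_on A f -> smooth_fun_on A g.
Proof.
move=> oA fg hf c ac k; have hc := atlas_chart ac.
apply: is_Ck_eq (hf c ac k); first exact: chart_open.
by move=> _ [x [cx Ax] <-] /=; have [_ _ -> // _ _] := hc; exact: fg.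
Qed.

Lemma smooth_fun_on_subset A B f : A `<=` B -> smooth_fun_on B f ->
  smooth_fun_on A f.
Proof.
move=> AB hf c ac k; apply: is_Ck_subset (hf c ac k).
by move=> _ [x [cx Ax] <-]; exists x => //; split => //; exact: AB.
Qed.

Lemma smooth_fun_on_cst A (a : R) : smooth_fun_on A (cst a).
Proof. by move=> c ac k; exact: is_Ck_cst. Qed.

Lemma smooth_fun_onD A f g : open A -> smooth_fun_on A f -> smooth_fun_on A g ->
  smooth_fun_on A (fun x => f x + g x).
Proof.
move=> oA hf hg c ac k; have oB := chart_open (atlas_chart ac) oA.
exact: (is_CkD oB (hf c ac k) (hg c ac k)).
Qed.

Lemma smooth_fun_onN A f : open A -> smooth_fun_on A f ->
  smooth_fun_on A (fun x => - f x).
Proof.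
move=> oA hf c ac k; have oB := chart_open (atlas_chart ac) oA.
exact: (is_CkN oB (hf c ac k)).
Qed.

Lemma smooth_fun_onM A f g : open A -> smooth_fun_on A f -> smooth_fun_on A g ->
  smooth_fun_on A (fun x => f x * g x).
Proof.
move=> oA hf hg c ac k; have oB := chart_open (atlas_chart ac) oA.
exact: (is_CkM oB (hf c ac k) (hg c ac k)).
Qed.

Lemma smooth_fun_on_sum A (I : Type) (s : seq I) (f : I -> M -> R) : open A ->
  (forall i, smooth_fun_on A (f i)) ->
  smooth_fun_on A (fun x => \sum_(i <- s) f i x).
Proof.
move=> oA hf c ac k; have oB := chart_open (atlas_chart ac) oA.
exact: (is_Ck_sum s oB (fun i => hf i c ac k)).
Qed.

Lemma smooth_fun_on_prod A (I : Type) (s : seq I) (f : I -> M -> R) : open A ->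
  (forall i, smooth_fun_on A (f i)) ->
  smooth_fun_on A (fun x => \prod_(i <- s) f i x).
Proof.
move=> oA hf c ac k; have oB := chart_open (atlas_chart ac) oA.
exact: (is_Ck_prod s oB (fun i => hf i c ac k)).
Qed.

Lemma smooth_fun_onV A f : open A -> (forall x, A x -> f x != 0) ->
  smooth_fun_on A f -> smooth_fun_on A (fun x => (f x)^-1).
Proof.
move=> oA f0 hf c ac k; have oB := chart_open (atlas_chart ac) oA.
apply: (is_CkV oB _ (hf c ac k)) => _ [x [cx Ax] <-] /=.
by have [_ _ -> // _ _] := atlas_chart ac; exact: f0.
Qed.

Lemma smooth_fun_on_det A r (f : M -> 'M[R]_r) : open A ->
  (forall i j, smooth_fun_on A (fun x => f x i j)) ->
  smooth_fun_on A (fun x => \det (f x)).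
Proof.
move=> oA hf; apply: smooth_fun_on_sum => // s.
apply: smooth_fun_onM => //; first exact: smooth_fun_on_cst.
by apply: smooth_fun_on_prod => // i.
Qed.

(** By Cramer's formula the entries of the inverse are cofactors divided by a determinant that does
    not vanish on A. *)
Lemma smooth_fun_on_invmx A r (f : M -> 'M[R]_r) i j : open A ->
  (forall x, A x -> f x \in unitmx) ->
  (forall i j, smooth_fun_on A (fun x => f x i j)) ->
  smooth_fun_on A (fun x => invmx (f x) i j).
Proof.
move=> oA fu hf.
apply: (@smooth_fun_on_eq _ (fun x => (\det (f x))^-1 *
   ((-1) ^+ (j + i) * \det (row' j (col' i (f x)))))) => //.
  by move=> x Ax; rewrite /invmx fu // !mxE.
apply: smooth_fun_onM => //.
  apply: smooth_fun_onV => //; last exact: smooth_fun_on_det.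
  by move=> x Ax; rewrite -unitfE -unitmxE fu.
apply: smooth_fun_onM => //; first exact: smooth_fun_on_cst.
apply: smooth_fun_on_det => // k l.
by under eq_fun do rewrite !mxE; exact: hf.
Qed.

Lemma smooth_fun_on_comp (h : M -> M) A f : smooth_map h -> open A ->
  smooth_fun_on A f -> smooth_fun_on (h @^-1` A) (f \o h).
Proof.
move=> [ch sh] oA hf c ac k; apply: is_Ck_local => _ [x [cx Ax] <-].
pose d := chart_at (h x); have ad : atlas d by exact: chart_at_atlas.
have hd := atlas_chart ad; have hc := atlas_chart ac.
have dK : forall x, cdom d x -> cinv d (cmap d x) = x by have [] := hd.
have cK : forall x, cdom c x -> cinv c (cmap c x) = x by have [] := hc.
have oB : open (cmap c @` (cdom c `&` h @^-1` (cdom d `&` A))).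
  apply: chart_open => //; apply: open_comp; first by move=> y _; exact: ch.
  by apply: openI => //; have [] := hd.
exists (cmap c @` (cdom c `&` h @^-1` (cdom d `&` A))).
  by split => //; exists x => //; split => //; split => //; exact: chart_at_dom.
apply: (@is_Ck_eq _ _ _ k _ ((f \o cinv d) \o (cmap d \o h \o cinv c))) => //.
  by move=> _ [y [cy [dy Ay]] <-] /=; rewrite cK // dK.
apply: (@is_Ck_comp _ _ _ k _ _ _ _ oB _ _ (hf d ad k)).
  by move=> _ [y [cy [dy Ay]] <-] /=; rewrite cK //; exists (h y).
by apply: is_Ck_subset (sh c d ac ad k) => _ [y [cy [dy Ay]] <-] /=; exists y.
Qed.

Lemma smooth_fun_on_coord c i : coordinates c ->
  smooth_fun_on (cdom c) (fun x => cmap c x 0 i).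
Proof.
move=> cc; have hc := cc.1; have oc : open (cdom c) by have [] := hc.
have oB := chart_open hc oc.
apply: (chart_smooth_on cc) => // k.
apply: (is_Ck_eq oB _ (is_Ck_id_coord k i oB)).
by move=> _ [y [cy _] <-] /=; have [_ _ -> // _ _] := hc.
Qed.

Lemma smooth_differentiable c A f x : coordinates c -> open A -> A x -> cdom c x ->
  smooth_fun_on A f -> differentiable (f \o cinv c) (cmap c x).
Proof.
move=> cc oA Ax cx hf; have [h _] := smooth_on_chart cc oA hf 1%N.
by apply: h; exists x.
Qed.

Lemma pderiv_eq c f g i x : is_chart c -> cdom c x ->
  (\forall y \near x, f y = g y) -> pderiv c i f x = pderiv c i g x.
Proof. by move=> hc cx fg; apply: near_eq_derive; exact: near_cinv fg. Qed.

Lemma pderiv_cst c (a : R) i x : pderiv c i (cst a) x = 0.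
Proof. exact: derive_cst. Qed.

Lemma pderivD c A f g i x : coordinates c -> open A -> A x -> cdom c x ->
  smooth_fun_on A f -> smooth_fun_on A g ->
  pderiv c i (fun y => f y + g y) x = pderiv c i f x + pderiv c i g x.
Proof.
move=> cc oA Ax cx hf hg; apply: deriveD; apply: diff_derivable;
  exact: (smooth_differentiable cc oA Ax cx).
Qed.

Lemma pderivM c A f g i x : coordinates c -> open A -> A x -> cdom c x ->
  smooth_fun_on A f -> smooth_fun_on A g ->
  pderiv c i (fun y => f y * g y) x = f x * pderiv c i g x + pderiv c i f x * g x.
Proof.
move=> cc oA Ax cx hf hg.
have df : derivable (f \o cinv c) (cmap c x) (delta_mx 0 i).
  by apply: diff_derivable; exact: (smooth_differentiable cc oA Ax cx hf).
have dg : derivable (g \o cinv c) (cmap c x) (delta_mx 0 i).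
  by apply: diff_derivable; exact: (smooth_differentiable cc oA Ax cx hg).
have := deriveM df dg; rewrite /= ; have [_ _ -> // _ _] := cc.1.
by rewrite [pderiv c i f x * _]mulrC.
Qed.

Lemma pderiv_coord c i j x : coordinates c -> cdom c x ->
  pderiv c i (fun y => cmap c y 0 j) x = (i == j)%:R.
Proof.
move=> cc cx; have hc := cc.1; have oc : open (cmap c @` cdom c) by have [] := hc.
rewrite /pderiv (@near_eq_derive _ _ _ _ (fun v : 'rV[R]_m => v 0 j)).
  rewrite -[LHS]/('D_(delta_mx 0 i) (fun v : 'rV[R]_m => id v 0 j) (cmap c x)).
  have := @derive_mx _ _ 1 m id (cmap c x) (delta_mx 0 i) (@derivable_id _ _ _ _).
  by rewrite derive_id => /matrixP/(_ 0 j); rewrite !mxE eqxx eq_sym => ->.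
near=> y; have [z cz <-] : (cmap c @` cdom c) y.
  by near: y; apply: open_nbhs_nbhs; split => //; exists x.
by have [_ _ h _ _] := hc; rewrite /= h.
Unshelve. all: by end_near. Qed.

(** The closed set K plays the role of the support: O and the complement of K cover M, and
    smoothness of a product with chi is checked on each of them. Being 1 near p, and not only at p,
    makes chi invisible to derivatives at p. *)
Definition bump_fun (p : M) (O : set M) (chi : M -> R) : Prop :=
  [/\ smooth_fun chi, \forall x \near p, chi x = 1 &
      exists2 K, closed K /\ K `<=` O & forall x, ~ K x -> chi x = 0].

(** A cube bump read in a chart is extended by 0. For this to be smooth outside the chart, K must be
    closed in M and not merely in the chart domain: K is the image of a compact cube, hence compact,
    hence closed because M is Hausdorff. *)
Lemma bump_exists p O : open O -> O p -> exists chi, bump_fun p O chi.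
Proof.
move=> oO Op; pose c := chart_at p.
have ac : atlas c by exact: chart_at_atlas.
have cc := atlas_coordinates ac; have hc := cc.1.
have [od oc cK ccont ci] := hc.
have cp : cdom c p by exact: chart_at_dom.
have oT := chart_open hc oO.
have : nbhs (cmap c p) (cmap c @` (cdom c `&` O)).
  by apply: open_nbhs_nbhs; split => //; exists p.
move=> /nbhs_ballP[eps /= e0 epsT].
(* The cube bump vanishes off the cube of half-side 2 e; the division by 3 keeps this closed cube
   inside the open ball of radius eps. *)
pose e := eps / 3; have e1 : 0 < e by rewrite divr_gt0.
have [b [sb b1 b0]] := cube_bump (cmap c p) e1.
pose I i := `[cmap c p 0 i - 2 * e, cmap c p 0 i + 2 * e]%classic.
pose K' := [set v : 'rV[R]_m | forall i, I i (v 0 i)].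
have K'E v : K' v <-> forall i, `|v 0 i - cmap c p 0 i| <= 2 * e.
  split => h i; have := h i; rewrite /I /= in_itv /= ler_distl; by [].
have K'T : K' `<=` cmap c @` (cdom c `&` O).
  move=> v /K'E hv; apply: epsT; rewrite -ball_normE /ball_ /=.
  rewrite /Num.norm /= mx_normrE; apply/bigmax_ltP; split => // -[i j] _ /=.
  rewrite !mxE ord1 distrC; apply: le_lt_trans (hv j) _.
  rewrite /e; lra.
have cK' : compact K'.
  by apply: (@rV_compact R m I) => i; exact: segment_compact.
pose K := cinv c @` K'.
have clK : closed K.
  apply: compact_closed; first exact: manifold_hausdorff.
  apply: continuous_compact => //; apply: continuous_in_subspaceT => v.
  by rewrite inE => /K'T[x [cx _] <-]; exact: ci.
have KO : K `<=` O by move=> _ [v /K'T[x [cx Ox] <-] <-]; rewrite cK.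
have Kc : K `<=` cdom c by move=> _ [v /K'T[x [cx Ox] <-] <-]; rewrite cK.
pose chi x := if `[< cdom c x >] then b (cmap c x) else 0.
have chi0 x : ~ K x -> chi x = 0.
  move=> nK; rewrite /chi; case: asboolP => // cx.
  have : ~ K' (cmap c x) by move=> h; apply: nK; exists (cmap c x) => //; exact: cK.
  move=> /K'E /existsNP[i /negP]; rewrite -ltNge => /ltW; exact: b0.
exists chi; split; last by exists K.
- apply: smooth_fun_on_local => x _.
  have [cx|ncx] := pselect (cdom c x).
    exists (cdom c) => //; apply: (chart_smooth_on cc) => // k.
    apply: (@is_Ck_eq _ _ _ k _ b); first exact: chart_open.
      by move=> _ [y [cy _] <-] /=; rewrite cK // /chi asboolT.
    exact: is_Ck_subset (sb k).
  have oKC : open (~` K) by rewrite openC.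
  exists (~` K); first by split => // /Kc.
  apply: (@smooth_fun_on_eq _ (cst 0)) => //; last exact: smooth_fun_on_cst.
  by move=> y /chi0.
- have : nbhs p (cmap c @^-1` (ball (cmap c p) e)).
    by apply: (ccont p cp); exact: nbhsx_ballx.
  have : nbhs p (cdom c) by exact: open_nbhs_nbhs.
  apply: filterS2 => x cx /= hx; rewrite /chi asboolT //; apply: b1 => i.
  move: hx; rewrite -ball_normE /ball_ /= => hx.
  have := le_trans _ (ltW hx); apply; rewrite /Num.norm /= mx_normrE.
  by apply: le_trans (le_bigmax _ _ (0, i)); rewrite /= !mxE distrC.
Qed.

Lemma smooth_bumpM p O chi f : open O -> bump_fun p O chi -> smooth_fun_on O f ->
  smooth_fun (fun x => chi x * f x).
Proof.
move=> oO [s1 _ [K [clK KO] chi0]] hf; apply: smooth_fun_on_local => x _.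
have [Ox|nOx] := pselect (O x).
  exists O => //; apply: smooth_fun_onM => //.
  by apply: smooth_fun_on_subset s1.
have oK : open (~` K) by rewrite openC.
exists (~` K); first by split => // /KO.
apply: (@smooth_fun_on_eq _ (cst 0)) => //; last exact: smooth_fun_on_cst.
by move=> y /chi0 ->; rewrite mul0r.
Qed.

End SmoothFun.

(** * Frames and sections *)

Section Bundle.
Context {R : realType} {m : nat} {M : manifold R m} {r : nat}.
Context {E : prebundle M r} (vE : vector_bundle E).
Implicit Types (A B O : set M) (f chi : M -> R) (s t : frame r E) (u v w : section E).

Lemma frame_sum s x (v : E x) : local_frame s -> fdom s x ->
  v = \sum_(a < r) coord (s x) a v *: (s x)`_a.
Proof. by move=> [_ hb _] sx; apply: (coord_basis (hb x sx)); exact: memvf. Qed.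

Lemma frame_coord s x (a b : 'I_r) : local_frame s -> fdom s x ->
  coord (s x) a (s x)`_b = (a == b)%:R.
Proof.
by move=> [_ hb _] sx; rewrite coord_free ?(basis_free (hb x sx)) // eq_sym.
Qed.

Lemma open_fdom s : local_frame s -> open (fdom s).
Proof. by case. Qed.

Lemma triv_local_frame t : trivs t -> local_frame t.
Proof. by move=> /vE.1. Qed.

Lemma triv_exists x : exists2 t : frame r E, trivs t & fdom t x.
Proof. exact: vE.2. Qed.

Lemma smooth_section_on_eq A u v : open A -> (forall x, A x -> u x = v x) ->
  smooth_section_on A u -> smooth_section_on A v.
Proof.
move=> oA uv h t tt a; apply: smooth_fun_on_eq (h t tt a).
  by apply: openI => //; exact/open_fdom/triv_local_frame.
by move=> x [Ax _]; rewrite uv.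
Qed.

Lemma smooth_section0 A : smooth_section_on A (fun x => 0 : E x).
Proof.
move=> t tt a; rewrite (_ : (fun x => _) = cst 0); first exact: smooth_fun_on_cst.
by apply/funext => x; rewrite linear0.
Qed.

Lemma smooth_sectionD A u v : open A -> smooth_section_on A u ->
  smooth_section_on A v -> smooth_section_on A (fun x => u x + v x).
Proof.
move=> oA hu hv t tt a.
have oB : open (A `&` fdom t) by apply: openI => //; exact/open_fdom/triv_local_frame.
under eq_fun do rewrite linearD.
by apply: smooth_fun_onD => //; [exact: hu|exact: hv].
Qed.

Lemma smooth_sectionZ A f u : open A -> smooth_fun_on A f -> smooth_section_on A u ->
  smooth_section_on A (fun x => f x *: u x).
Proof.
move=> oA hf hu t tt a.
have oB : open (A `&` fdom t) by apply: openI => //; exact/open_fdom/triv_local_frame.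
under eq_fun do rewrite linearZ.
apply: smooth_fun_onM => //; last exact: hu.
by apply: smooth_fun_on_subset hf => x [].
Qed.

Lemma smooth_section_sum A (I : Type) (q : seq I) (u : I -> section E) : open A ->
  (forall i, smooth_section_on A (u i)) ->
  smooth_section_on A (fun x => \sum_(i <- q) u i x).
Proof.
move=> oA hu; elim: q => [|i q IH].
  by apply: (smooth_section_on_eq oA _ (smooth_section0 A)) => x _; rewrite big_nil.
apply: (smooth_section_on_eq oA _ (smooth_sectionD oA (hu i) IH)) => x _.
by rewrite big_cons.
Qed.

(** Smoothness of u is given in trivialising frames t. Coordinates in s are obtained with the matrix
    T' of t in s; its smoothness comes from its being the inverse of T, the matrix of s in t, whose
    entries are smooth because s is a smooth frame. *)
Lemma smooth_coord A s u a : open A -> local_frame s -> smooth_section_on A u ->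
  smooth_fun_on (A `&` fdom s) (fun x => coord (s x) a (u x)).
Proof.
move=> oA ls hu; apply: smooth_fun_on_local => x [Ax sx].
have [t tt tx] := triv_exists x; have lt := triv_local_frame tt.
have oB : open (A `&` fdom s `&` fdom t).
  by apply: openI; [apply: openI => //; exact: open_fdom|exact: open_fdom].
exists (A `&` fdom s `&` fdom t) => //.
pose T x := \matrix_(b < r, a < r) coord (t x) b (s x)`_a.
pose T' x := \matrix_(b < r, a < r) coord (s x) b (t x)`_a.
have TT' y : fdom s y -> fdom t y -> T' y *m T y = 1%:M.
  move=> sy ty; apply/matrixP => i j; rewrite !mxE.
  transitivity (coord (s y) i (\sum_k coord (t y) k (s y)`_j *: (t y)`_k)).
    by rewrite linear_sum; apply: eq_bigr => k _; rewrite !mxE linearZ /= mulrC.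
  by rewrite -(frame_sum _ lt ty) frame_coord.
have Tu y : fdom s y -> fdom t y -> T y \in unitmx.
  by move=> sy ty; have /mulmx1_unit[] := TT' _ sy ty.
apply: (@smooth_fun_on_eq _ _ _ _
  (fun y => \sum_(b < r) invmx (T y) a b * coord (t y) b (u y))) => //.
  move=> y [[Ay sy] ty].
  have -> : invmx (T y) = T' y.
    by rewrite -[RHS]mulmx1 -(mulmxV (Tu y sy ty)) mulmxA TT' // mul1mx.
  rewrite [in RHS](frame_sum (u y) lt ty) linear_sum; apply: eq_bigr => b _.
  by rewrite mxE linearZ /= mulrC.
apply: smooth_fun_on_sum => // b; apply: smooth_fun_onM => //.
  apply: smooth_fun_on_invmx => //; first by move=> y [[Ay sy] ty]; exact: Tu.
  move=> i j; have [_ _ hs] := ls; under eq_fun do rewrite mxE.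
  by apply: smooth_fun_on_subset (hs j t tt i) => y [[Ay sy] ty].
by apply: smooth_fun_on_subset (hu t tt b) => y [[Ay sy] ty].
Qed.

Lemma smooth_bumpZ (p : M) O chi u : open O -> bump_fun p O chi -> smooth_section_on O u ->
  smooth_section (fun x => chi x *: u x).
Proof.
move=> oO hb hu t tt a; rewrite setTI.
have ot : open (fdom t) by exact/open_fdom/triv_local_frame.
have [s1 _ [K [clK KO] chi0]] := hb; apply: smooth_fun_on_local => x tx.
have [Ox|nOx] := pselect (O x).
  exists (O `&` fdom t); first by split => //; exact: openI.
  apply: (@smooth_sectionZ O chi u) => //.
  by apply: smooth_fun_on_subset s1.
have oK : open (~` K) by rewrite openC.
exists (~` K); first by split => // /KO.
apply: (@smooth_fun_on_eq _ _ _ _ (cst 0)) => //; last exact: smooth_fun_on_cst.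
by move=> y /chi0 ->; rewrite scale0r linear0.
Qed.

Lemma smooth_bump_frame (p : M) s chi (a : 'I_r) : local_frame s -> bump_fun p (fdom s) chi ->
  smooth_section (fun x => chi x *: (s x)`_a : E x).
Proof.
move=> ls hb.
apply: (@smooth_bumpZ p _ chi (fun x => (s x)`_a) _ hb); first exact: open_fdom.
by have [_ _ hs] := ls; exact: hs.
Qed.

Lemma smooth_bump_coord (p : M) s chi u a : local_frame s -> bump_fun p (fdom s) chi ->
  smooth_section u -> smooth_fun (fun x => chi x * coord (s x) a (u x)).
Proof.
move=> ls hb su; apply: smooth_bumpM hb _; first exact: open_fdom.
by have := @smooth_coord setT s u a openT ls su; rewrite setTI.
Qed.

Lemma bump1 (p : M) O chi : bump_fun p O chi -> chi p = 1.
Proof. by move=> [_ h _]; exact: (nbhs_singleton h). Qed.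

(** Allows an identity between vectors at p to be tested against global sections, on which the
    Koszul functional is defined. *)
Lemma section_extend p (v : E p) : exists2 u : section E, smooth_section u & u p = v.
Proof.
have [t tt tp] := triv_exists p; have lt := triv_local_frame tt.
have [chi hb] := bump_exists (open_fdom lt) tp.
exists (fun x => \sum_(a < r) coord (t p) a v *: (chi x *: (t x)`_a)).
  apply: smooth_section_sum => [|a]; first exact: openT.
  have h := smooth_bump_frame a lt hb.
  exact: (smooth_sectionZ openT (smooth_fun_on_cst _ (coord (t p) a v)) h).
rewrite [RHS](frame_sum v lt tp); apply: eq_bigr => a _.
by rewrite (bump1 hb) scale1r.
Qed.

Lemma frame_extend (p : M) s : local_frame s -> fdom s p ->
  exists2 u : 'I_r -> section E, forall a, smooth_section (u a) &
    forall a, \forall x \near p, u a x = (s x)`_a.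
Proof.
move=> ls sp; have [chi hb] := bump_exists (open_fdom ls) sp.
exists (fun a x => chi x *: (s x)`_a); first by move=> a; exact: (smooth_bump_frame a ls hb).
move=> a; have [_ + _] := hb; apply: filterS => x ->; exact: scale1r.
Qed.

(** Hence the square: one factor chi makes the coordinate of u a global function, the other makes
    the frame vector a global section. Off K both sides vanish, so the identity is global. *)
Lemma bump2_sum (p : M) s chi u x : local_frame s -> bump_fun p (fdom s) chi ->
  chi x ^+ 2 *: u x =
  \sum_(a < r) (chi x * coord (s x) a (u x)) *: (chi x *: (s x)`_a).
Proof.
move=> ls [_ _ [K [_ Ks] chi0]]; have [Kx|/chi0->] := pselect (K x).
  rewrite {1}(frame_sum (u x) ls (Ks x Kx)) scaler_sumr; apply: eq_bigr => a _.
  by rewrite !scalerA; congr (_ *: _); ring.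
by rewrite expr0n scale0r big1 // => a _; rewrite scale0r scaler0.
Qed.

End Bundle.

(** * Covariant 2-tensors *)

Section Expand.
Context {R : realType} {m : nat} {M : manifold R m} {r : nat}.
Context {E : prebundle M r} (vE : vector_bundle E).

Lemma smooth_section_lin (f : M -> R) (u v : section E) :
  smooth_fun f -> smooth_section u -> smooth_section v ->
  smooth_section (fun x => f x *: u x + v x).
Proof.
move=> sf su sv.
apply: (smooth_sectionD vE openT _ sv); exact: (smooth_sectionZ vE openT).
Qed.

Context {T : lmodType R} (Phi : section E -> T) (delta : (M -> R) -> R)
  (gam : section E -> T) (x : M).
Hypothesis PhiD : forall f u v, smooth_fun f -> smooth_section u ->
  smooth_section v ->
  Phi (fun y => f y *: u y + v y) = f x *: Phi u + Phi v + delta f *: gam u.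
Hypothesis delta1 : delta (cst 1) = 0.

(** [Phi] obeys a Leibniz rule at x with defect delta f *: gam u; delta = 0 is the case of a
    functional linear over functions. The hypothesis [delta1] enters through f = 1 and zero
    sections, where it gives Phi 0 = Phi 0 + Phi 0. *)
Lemma derivation_sum (I : Type) (q : seq I) (f : I -> M -> R)
    (u : I -> section E) : (forall i, smooth_fun (f i)) ->
  (forall i, smooth_section (u i)) ->
  Phi (fun y => \sum_(i <- q) f i y *: u i y) =
  \sum_(i <- q) (f i x *: Phi (u i) + delta (f i) *: gam (u i)).
Proof.
move=> sf su.
have s0 := smooth_section0 (E := E) setT.
have Phi0 : Phi (fun y => 0) = 0.
  have := PhiD (smooth_fun_on_cst setT 1) s0 s0; rewrite delta1 scale0r addr0 scale1r.
  have -> : (fun y => cst 1 y *: 0 + 0) = (fun y => 0 : E y).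
    by apply: functional_extensionality_dep => y; rewrite scaler0 addr0.
  by move=> h; apply: (@addrI _ (Phi (fun y => 0))); rewrite addr0.
elim: q => [|i q IH].
  rewrite big_nil -[RHS]Phi0; congr Phi; apply: functional_extensionality_dep => y.
  by rewrite big_nil.
rewrite big_cons -IH addrAC -PhiD //.
  congr Phi; apply: functional_extensionality_dep => y; exact: big_cons.
apply: (smooth_section_sum vE) => [|j]; first exact: openT.
exact: (smooth_sectionZ vE openT (sf j) (su j)).
Qed.

(* Both sides come from applying [Phi] to chi^2 u = sum_a (chi u^a) (chi s_a),
   an identity between global sections; [chi] is 1 at [x]. *)
Lemma derivation_expand s chi u : local_frame s -> bump_fun x (fdom s) chi ->
  delta (fun y => chi y ^+ 2) = 0 -> smooth_section u ->
  let S a : section E := fun y => chi y *: (s y)`_a in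
  Phi u = \sum_(a < r) (coord (s x) a (u x) *: Phi (S a) +
    delta (fun y => chi y * coord (s y) a (u y)) *: gam (S a)).
Proof.
move=> ls hb d2 su S.
have [sc _ _] := hb; have chi1 := bump1 hb.
have s0 := smooth_section0 (E := E) setT.
have sc2 : smooth_fun (fun y => chi y ^+ 2) by exact: (smooth_fun_onM openT sc sc).
have sS (a : 'I_r) : smooth_section (S a) by exact: (smooth_bump_frame vE a ls hb).
have h0 : Phi (fun y => 0) = 0.
  have := derivation_sum [::] (fun i : unit => smooth_fun_on_cst setT 0)
    (fun i : unit => s0).
  rewrite big_nil => <-; congr Phi; apply: functional_extensionality_dep => y.
  by rewrite big_nil.
have := PhiD sc2 su s0; rewrite d2 scale0r chi1 expr1n scale1r h0 !addr0 => <-.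
rewrite (_ : (fun y => _) = (fun y => \sum_(a < r) (chi y * coord (s y) a (u y)) *: S a y)).
  rewrite derivation_sum //.
    by apply: eq_bigr => a _; rewrite chi1 mul1r.
  by move=> a; exact: (smooth_bump_coord vE a ls hb su).
by apply: functional_extensionality_dep => y; rewrite addr0; exact: (bump2_sum _ _ ls hb).
Qed.

End Expand.

(** * Bilinearity, frame expression and smoothness *)

Section Tensor.
Context {R : realType} {m : nat} {M : manifold R m} {r : nat}.
Context {E : prebundle M r} (vE : vector_bundle E).
Context {g : tensor02 E} (sg : smooth_tensor g).
Implicit Types (u v w : section E).

Lemma tensorPl x k (u v w : E x) : g (k *: u + v) w = k * g u w + g v w.
Proof. by case: sg => h _; case: (h x k u v w). Qed.

Lemma tensorPr x k (u v w : E x) : g w (k *: u + v) = k * g w u + g w v.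
Proof. by case: sg => h _; case: (h x k u v w). Qed.

Lemma tensor0l x (w : E x) : g 0 w = 0.
Proof.
have := tensorPl 1 0 0 w; rewrite scaler0 addr0 mul1r => h.
by apply: (@addrI _ (g 0 w)); rewrite addr0.
Qed.

Lemma tensor0r x (w : E x) : g w 0 = 0.
Proof.
have := tensorPr 1 0 0 w; rewrite scaler0 addr0 mul1r => h.
by apply: (@addrI _ (g w 0)); rewrite addr0.
Qed.

Lemma tensorZl x k (u w : E x) : g (k *: u) w = k * g u w.
Proof. by rewrite -[k *: u]addr0 tensorPl tensor0l addr0. Qed.

Lemma tensorZr x k (u w : E x) : g w (k *: u) = k * g w u.
Proof. by rewrite -[k *: u]addr0 tensorPr tensor0r addr0. Qed.

Lemma tensorDl x (u v w : E x) : g (u + v) w = g u w + g v w.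
Proof. by rewrite -[u]scale1r tensorPl mul1r scale1r. Qed.

Lemma tensorDr x (u v w : E x) : g w (u + v) = g w u + g w v.
Proof. by rewrite -[u]scale1r tensorPr mul1r scale1r. Qed.

Lemma tensorNl x (u w : E x) : g (- u) w = - g u w.
Proof. by rewrite -scaleN1r tensorZl mulN1r. Qed.

Lemma tensor_suml x (I : Type) (q : seq I) (u : I -> E x) (w : E x) :
  g (\sum_(i <- q) u i) w = \sum_(i <- q) g (u i) w.
Proof.
by elim: q => [|i q IH]; rewrite ?big_nil ?tensor0l // !big_cons tensorDl IH.
Qed.

Lemma tensor_sumr x (I : Type) (q : seq I) (u : I -> E x) (w : E x) :
  g w (\sum_(i <- q) u i) = \sum_(i <- q) g w (u i).
Proof.
by elim: q => [|i q IH]; rewrite ?big_nil ?tensor0r // !big_cons tensorDr IH.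
Qed.

Lemma tensor_frame s x (u v : E x) : local_frame s -> fdom s x ->
  g u v = \sum_(a < r) \sum_(b < r)
    coord (s x) a u * coord (s x) b v * tensor_mx g s x a b.
Proof.
move=> ls sx; rewrite {1}(frame_sum u ls sx) tensor_suml; apply: eq_bigr => a _.
rewrite tensorZl {1}(frame_sum v ls sx) tensor_sumr mulr_sumr; apply: eq_bigr => b _.
by rewrite tensorZr mxE mulrA.
Qed.

Lemma tensor_smooth A u v : open A -> smooth_section_on A u -> smooth_section_on A v ->
  smooth_fun_on A (fun x => g (u x) (v x)).
Proof.
move=> oA su sv; apply: smooth_fun_on_local => x Ax.
have [t tt tx] := triv_exists vE x; have lt := triv_local_frame vE tt.
have oB : open (A `&` fdom t) by apply: openI => //; exact: open_fdom.
exists (A `&` fdom t) => //.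
apply: (@smooth_fun_on_eq _ _ _ _ (fun x => \sum_(a < r) \sum_(b < r)
    coord (t x) a (u x) * coord (t x) b (v x) * tensor_mx g t x a b)) => //.
  by move=> y [_ ty]; rewrite (tensor_frame (u y) (v y) lt ty).
apply: smooth_fun_on_sum => // a; apply: smooth_fun_on_sum => // b.
apply: smooth_fun_onM => //.
  by apply: smooth_fun_onM => //; [exact: su|exact: sv].
by apply: smooth_fun_on_subset (sg.2 t tt a b) => y [].
Qed.

End Tensor.

(** * Symmetry and nondegeneracy in arbitrary frames *)

Section Pseudometric.
Context {R : realType} {m : nat} {M : manifold R m} {r : nat}.
Context {E : prebundle M r} (vE : vector_bundle E).
Context {g : tensor02 E} (pg : pseudometrical g).

Lemma tensorC x (u v : E x) : g u v = g v u.
Proof.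
have [sg hg] := pg; have [t tt tx] := triv_exists vE x.
have lt := triv_local_frame vE tt; have [ht _] := hg t x tt tx.
rewrite (tensor_frame sg u v lt tx) (tensor_frame sg v u lt tx) [LHS]exchange_big /=.
apply: eq_bigr => a _; apply: eq_bigr => b _.
by rewrite -[in LHS]ht mxE [_ * coord _ a _]mulrC.
Qed.

Lemma tensor_nondeg x (u : E x) : (forall w : E x, g u w = 0) -> u = 0.
Proof.
move=> h; have [sg hg] := pg; have [t tt tx] := triv_exists vE x.
have lt := triv_local_frame vE tt; have [_ ht] := hg t x tt tx.
pose U := \row_a coord (t x) a u.
have UG : U *m tensor_mx g t x = 0.
  apply/rowP => b; rewrite [RHS]mxE; transitivity (g u (t x)`_b); last exact: h.
  rewrite [in RHS](frame_sum u lt tx) (tensor_suml sg) mxE.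
  by apply: eq_bigr => a _; rewrite (tensorZl sg) !mxE.
have U0 : U = 0 by rewrite -[U](mulmxK ht) UG mul0mx.
rewrite (frame_sum u lt tx) big1 // => a _.
by have /rowP/(_ a) := U0; rewrite !mxE => ->; rewrite scale0r.
Qed.

(** Nondegeneracy is assumed in trivialising frames; the frame-free form [tensor_nondeg] carries it
    to any local frame, a row killed by the matrix being the coordinates of a vector orthogonal to
    all vectors. *)
Lemma tensor_unitmx s x : local_frame s -> fdom s x -> tensor_mx g s x \in unitmx.
Proof.
move=> ls sx; have [sg hg] := pg.
rewrite -row_free_unit -kermx_eq0; apply/eqP/row_matrixP => i; rewrite row0.
have /sub_kermxP := row_sub i (kermx (tensor_mx g s x)).
move: (row i _) => v vG; apply/rowP => a; rewrite mxE.
have : \sum_(a < r) v 0 a *: (s x)`_a = 0 :> E x.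
  apply: tensor_nondeg => w; rewrite (frame_sum w ls sx) (tensor_sumr sg) big1 // => b _.
  rewrite (tensorZr sg) (tensor_suml sg).
  have h : \sum_k v 0 k * tensor_mx g s x k b = 0.
    by have /rowP/(_ b) := vG; rewrite !mxE.
  rewrite (_ : \sum_(i < r) _ = 0) ?mulr0 // -[RHS]h; apply: eq_bigr => k _.
  by rewrite (tensorZl sg) [in RHS]mxE.
move=> /(congr1 (coord (s x) a)); rewrite linear0 linear_sum (bigD1 a) //= linearZ /=.
rewrite frame_coord // eqxx mulr1 big1 ?addr0 // => b ba.
by rewrite linearZ /= frame_coord // eq_sym (negbTE ba) mulr0.
Qed.

End Pseudometric.

(** * The Koszul functional *)

Section Koszul.
Context {R : realType} {m : nat} {M : manifold R m} {r : nat}.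
Context {E : prebundle M r} (vE : vector_bundle E).
Context {B : section E -> section E -> section E}
  {A : section E -> (M -> R) -> M -> R} (hL : lie_structure B A).

(** [lie_structure] does not state that A u f is linear over functions in u and a derivation in f;
    both are read off from such an expression at a single point. *)
Definition anchor_at (c : chart R m M) (s : frame r E)
    (P : 'I_r -> 'I_m -> M -> R) (x : M) : Prop :=
  forall (u : section E) (f : M -> R), smooth_section u -> smooth_fun f ->
    A u f x = \sum_(a < r) \sum_(i < m)
      coord (s x) a (u x) * P a i x * pderiv c i f x.

Hypothesis hA : forall x, exists c s P,
  [/\ coordinates c, cdom c x & anchor_at c s P x].

Implicit Types (u v w : section E) (f p q : M -> R) (x y : M).

Lemma smooth_br u v : smooth_section u -> smooth_section v -> smooth_section (B u v).
Proof. by case: hL => h _; exact: h. Qed.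

Lemma br_linr (k : R) u v w x : smooth_section u -> smooth_section v ->
  smooth_section w -> B w (fun y => k *: u y + v y) x = k *: B w u x + B w v x.
Proof. by case: hL => _ [h _] su sv sw; case: (h k u v w su sv sw x). Qed.

Lemma br_anti u v x : smooth_section u -> smooth_section v -> B u v x = - B v u x.
Proof. by case: hL => _ [_ [h _]] su sv; exact: h. Qed.

Lemma br_leibniz u v f x : smooth_section u -> smooth_section v -> smooth_fun f ->
  B u (fun y => f y *: v y) x = f x *: B u v x + A u f x *: v x.
Proof. by case: hL => _ [_ [_ [_ [h _]]]] su sv sf; exact: h. Qed.

Lemma brr u v w f x : smooth_section u -> smooth_section v -> smooth_section w ->
  smooth_fun f -> B u (fun y => f y *: v y + w y) x =
  f x *: B u v x + B u w x + A u f x *: v x.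
Proof.
move=> su sv sw sf; have sfv := smooth_sectionZ vE openT sf sv.
have := br_linr 1 x sfv sw su; rewrite br_leibniz // scale1r.
rewrite (_ : (fun y => _) = (fun y => f y *: v y + w y)) => [->|].
  by rewrite addrAC.
by apply: functional_extensionality_dep => y; rewrite scale1r.
Qed.

Lemma brl u v w f x : smooth_section u -> smooth_section v -> smooth_section w ->
  smooth_fun f -> B (fun y => f y *: v y + w y) u x =
  f x *: B v u x + B w u x - A u f x *: v x.
Proof.
move=> su sv sw sf; have sfvw := smooth_section_lin vE sf sv sw.
rewrite br_anti // brr // (br_anti x su sv) (br_anti x su sw).
by rewrite !opprD scalerN !opprK.
Qed.

(* The Leibniz rule gives (A u f) v = B u (f v) - f B u v; the index [a] only
   ensures that the bundle has a nonzero local section [v]. *)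
Lemma smooth_anchor (a : 'I_r) u f : smooth_section u -> smooth_fun f ->
  smooth_fun (A u f).
Proof.
move=> su sf; apply: smooth_fun_on_local => x _.
have [t tt tx] := triv_exists vE x; have lt := triv_local_frame vE tt.
have [chi hb] := bump_exists (open_fdom lt) tx.
pose v : section E := fun y => chi y *: (t y)`_a.
have sv : smooth_section v by exact: (smooth_bump_frame vE a lt hb).
have sfv := smooth_sectionZ vE openT sf sv.
have sw : smooth_section (fun y => B u (fun y => f y *: v y) y + (- f y) *: B u v y).
  apply: (smooth_sectionD vE openT); first exact: smooth_br.
  apply: (smooth_sectionZ vE openT (smooth_fun_onN openT sf)); exact: smooth_br.
have [_ h1 _] := hb.
have : nbhs x [set y | chi y = 1 /\ fdom t y].
  apply: filterI => //; apply: open_nbhs_nbhs; split => //; exact: open_fdom.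
rewrite nbhsE => -[W oW hW]; exists W => //.
apply: (@smooth_fun_on_eq _ _ _ _ (fun y => coord (t y) a
    (B u (fun y => f y *: v y) y + (- f y) *: B u v y))); first exact: oW.1.
  move=> y /hW[cy ty]; rewrite br_leibniz //.
  rewrite scaleNr addrAC subrr add0r.
  by rewrite /v cy scale1r linearZ /= frame_coord // eqxx mulr1.
have := smooth_coord vE a openT lt sw; rewrite setTI.
by apply: smooth_fun_on_subset => y /hW[].
Qed.

Lemma anchor_lin u v f p x : smooth_section u -> smooth_section v ->
  smooth_fun f -> smooth_fun p ->
  A (fun y => f y *: u y + v y) p x = f x * A u p x + A v p x.
Proof.
move=> su sv sf sp; have sfuv := smooth_section_lin vE sf su sv.
have [c [s [P [cc cx h]]]] := hA x; rewrite !h // mulr_sumr -big_split.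
apply: eq_bigr => a _ /=; rewrite mulr_sumr -big_split; apply: eq_bigr => i _ /=.
by rewrite linearD linearZ /=; ring.
Qed.

Lemma anchor_leib u f p q x : smooth_section u -> smooth_fun f ->
  smooth_fun p -> smooth_fun q ->
  A u (fun y => f y * p y + q y) x = f x * A u p x + A u f x * p x + A u q x.
Proof.
move=> su sf sp sq; have sfp := smooth_fun_onM openT sf sp.
have sfpq := smooth_fun_onD openT sfp sq.
have [c [s [P [cc cx h]]]] := hA x; rewrite !h // mulr_sumr mulr_suml -!big_split.
apply: eq_bigr => a _ /=; rewrite mulr_sumr mulr_suml -!big_split.
apply: eq_bigr => i _ /=.
by rewrite (pderivD _ cc openT) // (pderivM _ cc openT) //; ring.
Qed.

Lemma anchor_near u f p x : smooth_section u -> smooth_fun f -> smooth_fun p ->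
  (\forall y \near x, f y = p y) -> A u f x = A u p x.
Proof.
move=> su sf sp fp; have [c [s [P [cc cx h]]]] := hA x; rewrite !h //.
by apply: eq_bigr => a _; apply: eq_bigr => i _; rewrite (pderiv_eq _ cc.1 cx fp).
Qed.

Lemma anchor_cst u (k : R) x : smooth_section u -> A u (cst k) x = 0.
Proof.
move=> su; have [c [s [P [cc cx h]]]] := hA x.
rewrite h //; last exact: smooth_fun_on_cst.
by apply: big1 => a _; apply: big1 => i _; rewrite pderiv_cst mulr0.
Qed.

Lemma anchor_bump2 u O chi x : smooth_section u -> bump_fun x O chi ->
  A u (fun y => chi y ^+ 2) x = 0.
Proof.
move=> su [sc c1 _]; rewrite -(anchor_cst 1 x su); apply: anchor_near => //.
- exact: (smooth_fun_onM openT sc sc).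
- exact: smooth_fun_on_cst.
- by apply: filterS c1 => y ->; rewrite expr1n.
Qed.

Context {g : tensor02 E} (pg : pseudometrical g).
Let sg : smooth_tensor g := pg.1.

Definition inner (u v : section E) (y : M) : R := g (u y) (v y).

Lemma smooth_inner u v : smooth_section u -> smooth_section v -> smooth_fun (inner u v).
Proof. by move=> su sv; exact: (tensor_smooth vE sg openT). Qed.

Lemma inner_linl u v w f : inner (fun y => f y *: u y + v y) w =
  fun y => f y * inner u w y + inner v w y.
Proof. by apply/funext => y; rewrite /inner (tensorPl sg). Qed.

Lemma inner_linr u v w f : inner w (fun y => f y *: u y + v y) =
  fun y => f y * inner w u y + inner w v y.
Proof. by apply/funext => y; rewrite /inner (tensorPr sg). Qed.

(* The order of the arguments of [inner] and [B] matches [christoffel] term by term. *)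
Definition koszul (u v w : section E) (x : M) : R :=
  A u (inner v w) x + A v (inner w u) x - A w (inner v u) x
  - g (B v u x) (w x) - g (B v w x) (u x) + g (B w u x) (v x).

(** The terms A_v f and A_w f coming from the derivatives of g(w, u) and g(v, u) cancel those coming
    from the brackets [v, u] and [w, u]. *)
Lemma koszul_linl f u u' v w x : smooth_fun f -> smooth_section u ->
  smooth_section u' -> smooth_section v -> smooth_section w ->
  koszul (fun y => f y *: u y + u' y) v w x = f x * koszul u v w x + koszul u' v w x.
Proof.
move=> sf su su' sv sw; have si := smooth_inner.
rewrite /koszul !(inner_linl, inner_linr) anchor_lin ?anchor_leib ?brr //; try exact: si.
rewrite !(tensorPl sg, tensorPr sg, tensorDl sg, tensorDr sg, tensorZl sg, tensorZr sg).
by rewrite /inner ?(tensorC vE pg (w x) (u x)) ?(tensorC vE pg (w x) (v x))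
  ?(tensorC vE pg (v x) (u x)); ring.
Qed.

(** Here A_u f and A_v f cancel, between the derivatives of g(v, w) and g(w, u) and the brackets
    [w, u] and [v, w]. *)
Lemma koszul_linr f u v w w' x : smooth_fun f -> smooth_section u ->
  smooth_section v -> smooth_section w -> smooth_section w' ->
  koszul u v (fun y => f y *: w y + w' y) x = f x * koszul u v w x + koszul u v w' x.
Proof.
move=> sf su sv sw sw'; have si := smooth_inner.
rewrite /koszul !(inner_linl, inner_linr) anchor_lin ?anchor_leib ?brr ?brl //; try exact: si.
rewrite !(tensorPl sg, tensorPr sg, tensorDl sg, tensorDr sg).
rewrite !(tensorZl sg, tensorZr sg, tensorNl sg).
by rewrite /inner ?(tensorC vE pg (w x) (u x)) ?(tensorC vE pg (w x) (v x))
  ?(tensorC vE pg (v x) (u x)); ring.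
Qed.

(** In this slot the two terms in A_w f cancel, whereas the derivative of g(v, w) and the bracket
    [v, u] contribute the same A_u f g(v, w), whence the factor 2. *)
Lemma koszul_leibniz f u v v' w x : smooth_fun f -> smooth_section u ->
  smooth_section v -> smooth_section v' -> smooth_section w ->
  koszul u (fun y => f y *: v y + v' y) w x =
  f x * koszul u v w x + koszul u v' w x + 2 * A u f x * inner v w x.
Proof.
move=> sf su sv sv' sw; have si := smooth_inner.
rewrite /koszul !(inner_linl, inner_linr) anchor_lin ?anchor_leib ?brl //; try exact: si.
rewrite !(tensorPl sg, tensorPr sg, tensorDl sg, tensorDr sg).
rewrite !(tensorZl sg, tensorZr sg, tensorNl sg).
by rewrite /inner ?(tensorC vE pg (w x) (u x)) ?(tensorC vE pg (w x) (v x))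
  ?(tensorC vE pg (v x) (u x)); ring.
Qed.

Lemma koszul_torsion u v w x : smooth_section u -> smooth_section v ->
  smooth_section w ->
  koszul u v w x - koszul v u w x = 2 * g (B u v x) (w x).
Proof.
move=> su sv sw; rewrite /koszul.
have iC u1 u2 : inner u1 u2 = inner u2 u1.
  by apply/funext => y; exact: (tensorC vE pg).
rewrite (iC v w) (iC w u) (iC u v) (br_anti x sv su) (br_anti x sv sw) (br_anti x su sw).
by rewrite !(tensorNl sg); ring.
Qed.

Lemma koszul_compat u v w x : smooth_section u -> smooth_section v ->
  smooth_section w ->
  koszul u v w x + koszul u w v x = 2 * A u (inner v w) x.
Proof.
move=> su sv sw; rewrite /koszul.
have iC u1 u2 : inner u1 u2 = inner u2 u1.
  by apply/funext => y; exact: (tensorC vE pg).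
rewrite (iC w v) (br_anti x sv sw).
by rewrite !(tensorNl sg); ring.
Qed.

Lemma smooth_koszul (a : 'I_r) u v w : smooth_section u -> smooth_section v ->
  smooth_section w -> smooth_fun (koszul u v w).
Proof.
move=> su sv sw; have si := smooth_inner; have sA := smooth_anchor a.
have D f p : smooth_fun f -> smooth_fun p -> smooth_fun (fun x => f x + p x).
  by move=> sf sp; exact: (smooth_fun_onD openT sf sp).
have N f : smooth_fun f -> smooth_fun (fun x => - f x).
  by move=> sf; exact: (smooth_fun_onN openT sf).
have sB u1 u2 u3 : smooth_section u1 -> smooth_section u2 -> smooth_section u3 ->
    smooth_fun (fun x => g (B u1 u2 x) (u3 x)).
  by move=> s1 s2; apply: si; exact: smooth_br.
apply: (D _ _ _ (sB w u v sw su sv)); apply: (D _ _ _ (N _ (sB v w u sv sw su))).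
apply: (D _ _ _ (N _ (sB v u w sv su sw))).
by apply: (D _ _ (D _ _ _ _) (N _ _)); apply: sA => //; exact: si.
Qed.

End Koszul.

(** * The Levi-Civita connection of an abstract Lie structure *)

Section Connection.
Context {R : realType} {m : nat} {M : manifold R m} {r : nat}.
Context {E : prebundle M r} (vE : vector_bundle E).
Context {B : section E -> section E -> section E}
  {A : section E -> (M -> R) -> M -> R} (hL : lie_structure B A).
Hypothesis hA : forall x, exists c s P,
  [/\ coordinates c, cdom c x & anchor_at (A := A) c s P x].
Context {g : tensor02 E} (pg : pseudometrical g).
Let sg : smooth_tensor g := pg.1.
Implicit Types (u v w : section E) (f p q : M -> R) (x y : M).
Let K := koszul (B := B) (A := A) (g := g).

Section Local.
Context {c : chart R m M} {s : frame r E} {P : 'I_r -> 'I_m -> M -> R}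
  {L : 'I_r -> 'I_r -> 'I_r -> M -> R} {x : M}.
Hypotheses (cc : coordinates c) (ls : local_frame s) (cx : cdom c x) (sx : fdom s x).
Hypotheses (hP : anchor_at (A := A) c s P x) (hLs : bracket_coefs B s L).
Context {chi : M -> R} (hb : bump_fun x (fdom s) chi).
Let S (a : 'I_r) : section E := fun y => chi y *: (s y)`_a.
Let G := tensor_mx g s.

(** The parenthesis of [christoffel], before the index d is raised. *)
Definition koszul_frame (e b d : 'I_r) : R :=
  \sum_(k < m) P e k x * pderiv c k (fun y => G y b d) x
     + \sum_(j < m) P b j x * pderiv c j (fun y => G y d e) x
     - \sum_(l < m) P d l x * pderiv c l (fun y => G y b e) x
     - \sum_(f < r) L b e f x * G x f d
     - \sum_(f < r) L b d f x * G x f e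
     + \sum_(f < r) L d e f x * G x f b.

Let sS a : smooth_section (S a).
Proof. exact: (smooth_bump_frame vE a ls hb). Qed.

Let S_near : \forall y \near x, chi y = 1.
Proof. by case: hb. Qed.

Let Sx a : S a x = (s x)`_a.
Proof. by rewrite /S (bump1 hb) scale1r. Qed.

Lemma anchor_frame e f : smooth_fun f ->
  A (S e) f x = \sum_(k < m) P e k x * pderiv c k f x.
Proof.
move=> sf; rewrite hP // (bigD1 e) //= [X in _ + X]big1 ?addr0 => [|a ae].
  by apply: eq_bigr => k _; rewrite Sx frame_coord // eqxx mul1r.
by apply: big1 => k _; rewrite Sx frame_coord // (negbTE ae) !mul0r.
Qed.

(** The functions of the local formula, such as metric entries or coordinates of a section, are
    smooth on the frame domain only; p stands for such a function and f for a global one with the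
    same germ at x. *)
Lemma anchor_frame_near e f p : smooth_fun f ->
  (\forall y \near x, f y = p y) ->
  A (S e) f x = \sum_(k < m) P e k x * pderiv c k p x.
Proof.
move=> sf fp; rewrite anchor_frame //; apply: eq_bigr => k _.
by rewrite (pderiv_eq k cc.1 cx fp).
Qed.

Lemma inner_frame a b : \forall y \near x, inner (g := g) (S a) (S b) y = G y a b.
Proof.
apply: filterS S_near => y cy.
by rewrite /inner /S cy !scale1r /G mxE.
Qed.

Lemma br_frame a b : B (S a) (S b) x = \sum_(e < r) L a b e x *: (s x)`_e.
Proof.
have : nbhs x [set y | chi y = 1 /\ fdom s y].
  apply: filterI => //; apply: open_nbhs_nbhs; split => //; exact: open_fdom.
rewrite nbhsE => -[W [oW Wx] hW]; apply: hLs (sS a) (sS b) oW _ _ _ Wx.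
  by move=> y /hW[].
by move=> y /hW[cy _]; rewrite /S cy !scale1r.
Qed.

Lemma koszul_frameE e b d : K (S e) (S b) (S d) x = koszul_frame e b d.
Proof.
rewrite /K /koszul !(anchor_frame_near _ (smooth_inner vE pg (sS _) (sS _)) (inner_frame _ _)).
rewrite !br_frame !Sx !(tensor_suml sg) /koszul_frame.
have h (a : 'I_r) (F : 'I_r -> R) :
    \sum_(f < r) g (F f *: (s x)`_f) (s x)`_a = \sum_(f < r) F f * G x f a.
  by apply: eq_bigr => f _; rewrite (tensorZl sg) /G mxE.
by rewrite !h.
Qed.

(** Lowering the index a: the factor 2 and the metric cancel 1/2 and the inverse metric, once the
    symmetry of the inverse has put the contraction in the order of a matrix product. *)
Lemma christoffel_metric e b d :
  2 * \sum_(a < r) christoffel c P L G a b e x * G x a d = koszul_frame e b d.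
Proof.
have uG := tensor_unitmx vE pg ls sx.
have GT : (G x)^T = G x by apply/matrixP => i j; rewrite !mxE (tensorC vE pg).
have GI : (invmx (G x))^T = invmx (G x) by rewrite trmx_inv GT.
transitivity (\sum_(a < r) \sum_(d' < r) koszul_frame e b d' * invmx (G x) d' a * G x a d).
  rewrite mulr_sumr; apply: eq_bigr => a _.
  rewrite /christoffel !mulrA mulfV ?pnatr_eq0 // mul1r mulr_suml.
  apply: eq_bigr => d' _; congr (_ * _); rewrite mulrC -/(koszul_frame e b d').
  by rewrite -[in RHS]GI mxE.
have : (\row_d' koszul_frame e b d') *m (invmx (G x) *m G x) = \row_d' koszul_frame e b d'.
  by rewrite mulVmx // mulmx1.
move=> /rowP/(_ d); rewrite mulmxA !mxE => h; rewrite -[RHS]h.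
apply: eq_bigr => a _; rewrite [(_ *m _) 0 a]mxE mulr_suml.
by apply: eq_bigr => d' _; rewrite [(\row_ _ _) 0 d']mxE.
Qed.

Definition local_connection (u v : section E) : E x :=
  \sum_(a < r)
     (\sum_(e < r) coord (s x) e (u x) *
       (\sum_(k < m) P e k x * pderiv c k (fun y => coord (s y) a (v y)) x +
        \sum_(b < r) christoffel c P L G a b e x * coord (s x) b (v x))) *: (s x)`_a.

(** The slot of u is expanded with zero defect, then the slot of v with defect 2 (A f) g. The defect
    terms give the derivatives of the coordinates of v, and the values of the functional on the
    cut-off frame give the Christoffel components. *)
Lemma koszul_local_frame u v d : smooth_section u -> smooth_section v ->
  K u v (S d) x = 2 * g (local_connection u v) (s x)`_d.
Proof.
move=> su sv.
have lin1 f u1 u2 : smooth_fun f -> smooth_section u1 -> smooth_section u2 ->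
    K (fun y => f y *: u1 y + u2 y) v (S d) x = f x *: (K u1 v (S d) x : R^o)
    + K u2 v (S d) x + (0 : R) *: (0 : R^o).
  move=> sf s1 s2; rewrite [LHS](koszul_linl vE hL hA pg) //.
  by rewrite scale0r addr0.
rewrite [LHS](derivation_expand vE (T := R^o) lin1 (erefl _) ls hb (erefl _) su).
rewrite /local_connection (tensor_suml sg) mulr_sumr.
under [RHS]eq_bigr => a _ do rewrite (tensorZl sg) mulr_suml mulr_sumr.
rewrite [RHS]exchange_big; apply: eq_bigr => e _ /=.
rewrite scale0r addr0 -[fun y => chi y *: (s y)`_e]/(S e).
have lin2 f v1 v2 : smooth_fun f -> smooth_section v1 -> smooth_section v2 ->
    K (S e) (fun y => f y *: v1 y + v2 y) (S d) x = f x *: (K (S e) v1 (S d) x : R^o)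
    + K (S e) v2 (S d) x + (2 * A (S e) f x) *: (inner (g := g) v1 (S d) x : R^o).
  by move=> sf s1 s2; rewrite [LHS](koszul_leibniz vE hL hA pg) //; exact: sS.
have d1 : 2 * A (S e) (cst 1) x = 0 by rewrite (anchor_cst hA) ?mulr0.
have d2 : 2 * A (S e) (fun y => chi y ^+ 2) x = 0.
  by rewrite (anchor_bump2 hA _ hb) ?mulr0.
rewrite [X in _ *: X](derivation_expand vE (T := R^o) lin2 d1 ls hb d2 sv).
rewrite -[LHS]/(coord (s x) e (u x) * _).
transitivity (coord (s x) e (u x) * (2 * \sum_(a < r)
   (\sum_(k < m) P e k x * pderiv c k (fun y => coord (s y) a (v y)) x +
    \sum_(b < r) christoffel c P L G a b e x * coord (s x) b (v x)) * G x a d)); last first.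
  rewrite !mulr_sumr; apply: eq_bigr => a _.
  by rewrite /G mxE; ring.
congr (_ * _).
under [in RHS]eq_bigr => a _ do rewrite mulrDl.
rewrite !big_split /= addrC mulrDr; congr (_ + _).
  rewrite mulr_sumr; apply: eq_bigr => a _.
  rewrite (anchor_frame_near _ (smooth_bump_coord vE a ls hb sv)
    (p := fun y => coord (s y) a (v y))).
    by rewrite -(nbhs_singleton (inner_frame a d)) [LHS]/GRing.scale /= mulrA.
  by apply: filterS S_near => y ->; rewrite mul1r.
under [in RHS]eq_bigr => a _ do rewrite mulr_suml.
rewrite exchange_big mulr_sumr; apply: eq_bigr => b _ /=.
rewrite -[fun y => chi y *: (s y)`_b]/(S b) koszul_frameE -christoffel_metric.
rewrite [LHS]/GRing.scale /= !mulr_sumr; apply: eq_bigr => a _; ring.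
Qed.

Lemma koszul_local u v w : smooth_section u -> smooth_section v -> smooth_section w ->
  K u v w x = 2 * g (local_connection u v) (w x).
Proof.
move=> su sv sw.
have lin1 f u1 u2 : smooth_fun f -> smooth_section u1 -> smooth_section u2 ->
    K u v (fun y => f y *: u1 y + u2 y) x = f x *: (K u v u1 x : R^o)
    + K u v u2 x + (0 : R) *: (0 : R^o).
  move=> sf s1 s2; rewrite [LHS](koszul_linr vE hL hA pg) //.
  by rewrite scale0r addr0.
rewrite [LHS](derivation_expand vE (T := R^o) lin1 (erefl _) ls hb (erefl _) sw).
rewrite {2}(frame_sum (w x) ls sx) (tensor_sumr sg) mulr_sumr; apply: eq_bigr => d _.
rewrite scale0r addr0 -[fun y => chi y *: (s y)`_d]/(S d) koszul_local_frame //.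
by rewrite (tensorZr sg) [LHS]/GRing.scale /=; ring.
Qed.

(** This is [koszul_compat] on three cut-off frame sections, halved. *)
Lemma christoffel_compat e a b :
  \sum_(k < m) P e k x * pderiv c k (fun y => G y a b) x
     - \sum_(d < r) christoffel c P L G d a e x * G x d b
     - \sum_(d < r) christoffel c P L G d b e x * G x a d = 0.
Proof.
have h := koszul_compat vE hL pg x (sS e) (sS a) (sS b).
rewrite -/K !koszul_frameE -!christoffel_metric -mulrDr in h.
have n2 : (2 : R) != 0 by rewrite pnatr_eq0.
have {}h := mulfI n2 h.
rewrite (anchor_frame_near _ (smooth_inner vE pg (sS _) (sS _)) (inner_frame _ _)) in h.
rewrite -h [X in _ - _ - X](_ : _ = \sum_(d < r) christoffel c P L G d b e x * G x d a).
  by rewrite -addrA -opprD subrr.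
by apply: eq_bigr => d _; rewrite /G !mxE (tensorC vE pg).
Qed.

End Local.

Hypothesis hLoc : forall x, exists c s P L, [/\ coordinates c, local_frame s,
  cdom c x /\ fdom s x, anchor_at (A := A) c s P x & bracket_coefs B s L].

(** The value is chosen by the frame-free equation, which turns agreement with the local formula in
    every chart and frame into a uniqueness statement. The default 0 is not reached for smooth u and
    v, as [koszul_local] supplies a solution. *)
Definition levi_civita (u v : section E) : section E := fun x =>
  xget 0 [set z : E x | forall w, smooth_section w -> K u v w x = 2 * g z (w x)].

Lemma levi_civitaE u v w x : smooth_section u -> smooth_section v -> smooth_section w ->
  K u v w x = 2 * g (levi_civita u v x) (w x).
Proof.
move=> su sv sw; rewrite /levi_civita; case: xgetP => [z _ h|h]; first exact: h.
have [c [s [P [L [cc ls [cx sx] hP hLs]]]]] := hLoc x.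
have [chi hb] := bump_exists (open_fdom ls) sx.
case: (h (local_connection (c := c) (s := s) (P := P) (L := L) (x := x) u v)).
move=> w' sw'; exact: (koszul_local cc ls cx sx hP hLs hb su sv sw').
Qed.

Lemma levi_civita_unique u v x (z : E x) : smooth_section u -> smooth_section v ->
  (forall w, smooth_section w -> K u v w x = 2 * g z (w x)) -> levi_civita u v x = z.
Proof.
move=> su sv h; apply/eqP; rewrite -subr_eq0; apply/eqP/(tensor_nondeg vE pg) => w.
have [w' sw' <-] := section_extend vE w.
rewrite (tensorDl sg) (tensorNl sg); apply/eqP; rewrite subr_eq0; apply/eqP.
have n2 : (2 : R) != 0 by rewrite pnatr_eq0.
by apply: (mulfI n2); rewrite -levi_civitaE // h.
Qed.

Lemma levi_civita_local c s P L x u v : coordinates c -> local_frame s ->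
  cdom c x -> fdom s x -> anchor_at (A := A) c s P x -> bracket_coefs B s L ->
  smooth_section u -> smooth_section v ->
  levi_civita u v x = local_connection (c := c) (s := s) (P := P) (L := L) (x := x) u v.
Proof.
move=> cc ls cx sx hP hLs su sv; apply: levi_civita_unique => // w sw.
have [chi hb] := bump_exists (open_fdom ls) sx.
exact: (koszul_local cc ls cx sx hP hLs hb su sv sw).
Qed.

Lemma levi_civita_torsion u v x : smooth_section u -> smooth_section v ->
  levi_civita u v x - levi_civita v u x - B u v x = 0.
Proof.
move=> su sv; apply: (tensor_nondeg vE pg) => w.
have [w' sw' <-] := section_extend vE w.
have n2 : (2 : R) != 0 by rewrite pnatr_eq0.
apply: (mulfI n2); rewrite !(tensorDl sg) !(tensorNl sg) !mulrDr !mulrN.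
rewrite -!levi_civitaE // mulr0 (koszul_torsion vE hL pg) //.
by rewrite subrr.
Qed.

(** In a trivialising frame the coordinates solve the linear system whose matrix is the metric and
    whose right-hand side is half the Koszul functional on frame sections, a smooth function. *)
Lemma smooth_levi_civita u v : smooth_section u -> smooth_section v ->
  smooth_section (levi_civita u v).
Proof.
move=> su sv t tt a; rewrite setTI; have lt := triv_local_frame vE tt.
apply: smooth_fun_on_local => x tx.
have [chi hb] := bump_exists (open_fdom lt) tx.
have : nbhs x [set y | chi y = 1 /\ fdom t y].
  have [_ h1 _] := hb.
  apply: filterI => //; apply: open_nbhs_nbhs; split => //; exact: open_fdom.
rewrite nbhsE => -[W oW hW]; exists W => //.
pose S (d : 'I_r) : section E := fun y => chi y *: (t y)`_d.
have sS d : smooth_section (S d) by exact: (smooth_bump_frame vE d lt hb).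
apply: (@smooth_fun_on_eq _ _ _ _ (fun y => \sum_(d < r)
    2^-1 * K u v (S d) y * invmx (tensor_mx g t y) d a)); first exact: oW.1.
  move=> y /hW[cy ty]; have uG := tensor_unitmx vE pg lt ty.
  pose z := \row_b coord (t y) b (levi_civita u v y).
  have : z *m tensor_mx g t y *m invmx (tensor_mx g t y) = z by rewrite mulmxK.
  move=> /rowP/(_ a); rewrite [RHS]mxE => <-; rewrite mxE; apply: eq_bigr => d _.
  congr (_ * _); rewrite levi_civitaE // mulrA mulVf ?pnatr_eq0 // mul1r.
  rewrite {1}(frame_sum (levi_civita u v y) lt ty) (tensor_suml sg) mxE.
  by apply: eq_bigr => b _; rewrite (tensorZl sg) /S cy scale1r !mxE.
apply: smooth_fun_on_sum => [|d]; first exact: oW.1.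
apply: smooth_fun_onM; first exact: oW.1.
  apply: smooth_fun_onM; [exact: oW.1|exact: smooth_fun_on_cst|].
  have hK : smooth_fun_on setT (K u v (S d)).
    (* The index d also serves as the witness of nonzero rank needed for the smoothness of A u f. *)
    exact: (smooth_koszul vE hL pg d su sv (sS d)).
  exact: (smooth_fun_on_subset (@subsetT _ W) hK).
apply: smooth_fun_on_invmx; first exact: oW.1.
  by move=> y /hW[_ ty]; exact: (tensor_unitmx vE pg lt ty).
by move=> i j; apply: smooth_fun_on_subset (sg.2 t tt i j) => y /hW[].
Qed.

End Connection.

(** * Generalized Lie algebroids *)

Section TangentCoord.
Context {R : realType} {m : nat} {M : manifold R m}.
Implicit Types (c d : chart R m M) (x : M).

Definition tangent_coord c x (v : 'rV[R]_m) : 'rV[R]_m :=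
  'D_v (cmap c \o cinv (chart_at x)) (cmap (chart_at x) x).

Lemma transition_differentiable c d x : smooth_transition c d -> cdom c x -> cdom d x ->
  differentiable (cmap d \o cinv c) (cmap c x).
Proof. by move=> t cx dx; have [h _] := t 1%N; apply: h; exists x. Qed.

Lemma tangent_coord_linear c x : coordinates c -> cdom c x ->
  linear (tangent_coord c x).
Proof.
move=> [_ cc] cx k u v; have ac := chart_at_atlas x.
have d := transition_differentiable (cc _ ac).2 (chart_at_dom x) cx.
by rewrite /tangent_coord !deriveE // linearP.
Qed.

Lemma tangent_coordP c x (k : R) (u v : 'rV[R]_m) i : coordinates c -> cdom c x ->
  tangent_coord c x (k *: u + v) 0 i =
  k * tangent_coord c x u 0 i + tangent_coord c x v 0 i.
Proof. by move=> cc cx; rewrite tangent_coord_linear // !mxE. Qed.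

Lemma chart_change_derive c x v (f : M -> R) (A : set M) : coordinates c -> cdom c x ->
  open A -> A x -> smooth_fun_on A f ->
  'D_v (f \o cinv (chart_at x)) (cmap (chart_at x) x) =
  \sum_(i < m) tangent_coord c x v 0 i * pderiv c i f x.
Proof.
move=> cc cx oA Ax sf; have ac := chart_at_atlas x.
have xx := chart_at_dom x; have [_ _ cK _ _] := cc.1.
have [_ _ aK _ _] := atlas_chart ac; have od : open (cdom c) by have [] := cc.1.
rewrite (@near_eq_derive _ _ _ _ ((f \o cinv c) \o (cmap c \o cinv (chart_at x)))).
  rewrite derive_comp_rV ?/= ?aK //.
    exact: (transition_differentiable (cc.2 _ ac).2).
  exact: (smooth_differentiable cc oA).
apply: filterS (near_cinv (atlas_chart ac) xx (open_nbhs_nbhs (conj od cx))) => y /= h.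
by rewrite cK.
Qed.

End TangentCoord.

(** * Existence of the local data of a generalized Lie algebroid *)

Section GenLieAlgebroid.
Context {R : realType} {m : nat} {M : manifold R m} {r : nat}.
Context {E : prebundle M r} {h hinv : M -> M}
  {rho : forall x, E x -> tangent_bundle M x}
  {br : section E -> section E -> section E}.
Hypothesis hG : gen_lie_algebroid h hinv rho br.
Implicit Types (u v w : section E) (f p q : M -> R) (x y : M).

Let Aop u : (M -> R) -> M -> R := vf_act (anchor_field h hinv rho u).
Let vE : vector_bundle E. Proof. by case: hG. Qed.
Let hK : cancel h hinv. Proof. by case: hG => _ []. Qed.
Let sh : smooth_map h. Proof. by case: hG => _ []. Qed.
Let hL : lie_structure br Aop. Proof. by case: hG. Qed.

Lemma rho_lin x (k : R) (u v : E x) : rho (k *: u + v) = k *: rho u + rho v.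
Proof. by case: hG => _ _ [+ _] _; exact. Qed.

Lemma rho0 x : rho (0 : E x) = 0.
Proof.
have := rho_lin 1 (0 : E x) 0; rewrite scaler0 addr0 scale1r => e.
by apply: (@addrI _ (rho (0 : E x))); rewrite addr0.
Qed.

(** Chain rule: T_x h (rho (u x)) acts on f as rho (u x) acts on f \o h. The field at h x thus
    depends on u through its value at x, not at h x, which is the tension exploited at points moved
    by h. *)
Lemma anchor_value u f c x : coordinates c -> cdom c x -> smooth_fun f ->
  Aop u f (h x) =
  \sum_(i < m) tangent_coord c x (rho (u x)) 0 i * pderiv c i (f \o h) x.
Proof.
move=> cc cx sf.
have shf : smooth_fun_on setT (f \o h).
  by have := smooth_fun_on_comp sh openT sf; rewrite preimage_setT.
rewrite -(chart_change_derive (rho (u x)) cc cx openT _ shf) //.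
pose a := chart_at x; pose d := chart_at (h x).
have aa : atlas a by exact: chart_at_atlas.
have ad : atlas d by exact: chart_at_atlas.
have ax : cdom a x by exact: chart_at_dom.
have dx : cdom d (h x) by exact: chart_at_dom.
have [_ _ aK _ _] := atlas_chart aa; have [od _ dK _ _] := atlas_chart ad.
have df1 : differentiable (cmap d \o h \o cinv a) (cmap a x).
  by have [+ _] := sh.2 a d aa ad 1%N; apply; exists x.
have fE : (anchor_field h hinv rho u (h x) : 'rV[R]_m) =
    'D_(rho (u x) : 'rV[R]_m) (cmap d \o h \o cinv a) (cmap a x).
  by rewrite /anchor_field /tangent_map (hK x).
have yE : (cmap d \o h \o cinv a) (cmap a x) = cmap d (h x) by rewrite /= aK.
have df2 z : z = cmap d (h x) -> differentiable (f \o cinv d) z.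
  move=> ->; exact: (smooth_differentiable (atlas_coordinates ad) openT (I : setT (h x)) dx sf).
rewrite /Aop /vf_act fE -/a -/d.
rewrite (@near_eq_derive _ _ _ (f \o h \o cinv a)
  ((f \o cinv d) \o (cmap d \o h \o cinv a))).
  rewrite [RHS]deriveE; last exact: (differentiable_comp df1 (df2 _ yE)).
  rewrite (diff_comp df1 (df2 _ yE)) [RHS]/(comp _ _ _) -(deriveE _ df1).
  by rewrite -(deriveE _ (df2 _ yE)) yE.
have hd : nbhs x (h @^-1` cdom d).
  by apply: sh.1; apply: open_nbhs_nbhs; split.
apply: filterS (near_cinv (atlas_chart aa) ax hd) => y /= hy.
by rewrite dK.
Qed.

Lemma anchor_pointwise u f x : smooth_fun f ->
  forall k v, u x = k *: v x -> Aop u f (h x) = k * Aop v f (h x).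
Proof.
move=> sf k v uv; have cc := chart_at_coordinates x; have cx := chart_at_dom x.
rewrite !(anchor_value _ cc cx sf) mulr_sumr; apply: eq_bigr => i _.
have t0 : tangent_coord (chart_at x) x 0 = 0.
  exact: derive0.
rewrite uv -[k *: v x]addr0 rho_lin rho0 tangent_coord_linear // t0 addr0.
by rewrite mxE mulrA.
Qed.

Lemma anchor_locally0 u f x : smooth_fun f -> (\forall y \near h x, f y = 0) ->
  Aop u f (h x) = 0.
Proof.
move=> sf f0; have cc := chart_at_coordinates x; have cx := chart_at_dom x.
rewrite (anchor_value _ cc cx sf); apply: big1 => i _.
rewrite (@pderiv_eq _ _ _ _ _ (cst 0) _ _ cc.1 cx) ?pderiv_cst ?mulr0 //.
exact: (sh.1 x _ f0).
Qed.

(* For [f] equal to 1 at [x] and to 0 near [h x], expand [f u, g v] at [h x]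
   with the Leibniz rule in either slot. *)
Lemma anchor_moved u g x : smooth_section u -> smooth_fun g -> h x <> x ->
  Aop u g (h x) = 0.
Proof.
move=> su sg hx; have [t tt tx] := triv_exists vE (h x).
have lt := triv_local_frame vE tt; have [r0|r_gt0] := posnP r.
  (* In rank 0 there is no nonzero vector to test on, but u x is itself 0. *)
  rewrite (anchor_pointwise sg (k := 0) (v := u)) ?mul0r // scale0r.
  have [t' tt' tx'] := triv_exists vE x.
  rewrite (frame_sum (u x) (triv_local_frame vE tt') tx') big1 // => a _.
  by exfalso; case: a => k; rewrite r0.
pose a := Ordinal r_gt0.
have o1 : open (~` [set h x]).
  rewrite openC; apply: accessible_closed_set1.
  by apply: hausdorff_accessible; exact: manifold_hausdorff.
have xo : (~` [set h x]) x by move=> /esym.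
have [f hb] := bump_exists o1 xo; have fx := bump1 hb.
have [sf _ [K [clK KO] f0]] := hb.
have nK : ~ K (h x) by move=> /KO; apply.
have f0' : \forall y \near h x, f y = 0.
  have oK : open (~` K) by rewrite openC.
  by apply: filterS (open_nbhs_nbhs (conj oK nK)) => y /f0.
have [v sv vx] := section_extend vE (t (h x))`_a.
have sfu := smooth_sectionZ vE openT sf su.
have sgv := smooth_sectionZ vE openT sg sv.
have e1 : br (fun y => f y *: u y) (fun y => g y *: v y) (h x) =
    Aop u g (h x) *: v (h x).
  rewrite (br_leibniz hL) // (br_anti hL) // (br_leibniz hL) //.
  rewrite (f0 _ nK) scale0r anchor_locally0 // scale0r addr0 oppr0 scaler0 add0r.
  rewrite (anchor_pointwise sg (k := 1) (v := u)) ?mul1r //.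
  by rewrite fx.
have e2 : br (fun y => f y *: u y) (fun y => g y *: v y) (h x) = 0.
  rewrite (br_anti hL) // (br_leibniz hL) // (f0 _ nK) scale0r.
  by rewrite anchor_locally0 // scale0r addr0 oppr0.
move: e1; rewrite e2 => /(congr1 (coord (t (h x)) a)).
by rewrite linear0 linearZ /= vx frame_coord // eqxx mulr1.
Qed.

(** The witness is the component of rho(s_a) at fixed points of h and 0 elsewhere. At a fixed point
    the values u x and u (h x) on the two sides coincide; at a moved point both sides vanish. *)
Lemma anchor_coefs_exist c (s : frame r E) : coordinates c -> local_frame s ->
  anchor_coefs h hinv rho c s (anchor_coef h hinv rho c s).
Proof.
move=> cc ls; rewrite /anchor_coef; apply: (xgetPex (fun _ _ _ => 0)).
exists (fun a i x => if `[< h x = x >] then tangent_coord c x (rho (s x)`_a) 0 i else 0).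
move=> u f su sf x cx sx; case: asboolP => [hx|hx]; last first.
  rewrite [LHS](anchor_moved su sf hx) big1 // => a _; rewrite big1 // => i _.
  by rewrite mulr0 mul0r.
have sx' : fdom s x by rewrite -hx.
rewrite [LHS](anchor_value _ cc cx sf) exchange_big; apply: eq_bigr => i _ /=.
rewrite -mulr_suml; congr (_ * _).
have -> : \sum_(a < r) coord (s (h x)) a (u (h x)) * tangent_coord c x (rho (s x)`_a) 0 i =
          \sum_(a < r) coord (s x) a (u x) * tangent_coord c x (rho (s x)`_a) 0 i.
  by rewrite hx.
rewrite {1}(frame_sum (u x) ls sx').
elim: (index_enum _) => [|a l IH].
  by rewrite !big_nil rho0 /tangent_coord derive0 mxE.
rewrite !big_cons rho_lin (tangent_coordP _ _ _ _ cc cx).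
by congr (_ + _); exact: IH.
Qed.

(* v = w + (1 - chi) (v - w) with chi = 1 at x. *)
Lemma br_near u v w x : smooth_section u -> smooth_section v -> smooth_section w ->
  (\forall y \near x, v y = w y) -> br u v x = br u w x.
Proof.
move=> su sv sw vw; have : nbhs x [set y | v y = w y] := vw.
rewrite nbhsE => -[W [oW Wx] hW].
have [chi hb] := bump_exists oW Wx; have [sc _ [K [clK KW] c0]] := hb.
pose f y := 1 + - chi y.
have sf : smooth_fun f.
  exact: (smooth_fun_onD openT (smooth_fun_on_cst _ 1) (smooth_fun_onN openT sc)).
have sd : smooth_section (fun y => -1 *: w y + v y).
  exact: (smooth_section_lin vE (smooth_fun_on_cst _ (-1)) sw sv).
have := brr vE hL x su sd sw sf.
rewrite (_ : (fun y => _) = v).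
  by rewrite /f (bump1 hb) subrr scale0r add0r (nbhs_singleton vw) scaleN1r addNr scaler0 addr0.
apply: functional_extensionality_dep => y; have [Ky|nKy] := pselect (K y).
  by rewrite (hW y (KW y Ky)) scaleN1r addNr scaler0 add0r.
by rewrite /f c0 // subr0 scale1r scaleN1r addrAC addNr add0r.
Qed.

(** By locality of the bracket ([br_near]) in either slot, any global extensions of the frame
    vectors near a point give the same bracket there; the witness uses cut-off frames. *)
Lemma bracket_coefs_exist (s : frame r E) : local_frame s ->
  bracket_coefs br s (bracket_coef br s).
Proof.
move=> ls; rewrite /bracket_coef; apply: (xgetPex (fun _ _ _ _ => 0)).
(* One bump function is chosen for each point; the default 0 is taken outside [fdom s], where the
   coefficients are unconstrained. *)
pose chi (y : M) := xget (fun=> 0) [set chi | bump_fun y (fdom s) chi].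
exists (fun a b e y => coord (s y) e
  (br (fun z => chi y z *: (s z)`_a) (fun z => chi y z *: (s z)`_b) y)).
move=> a b u v W su sv oW Ws uv x Wx; have sx := Ws x Wx.
have hb : bump_fun x (fdom s) (chi x).
  by apply: (xgetPex (fun=> 0)); exact: bump_exists (open_fdom ls) sx.
rewrite -(frame_sum _ ls sx).
have n1 a' (u' : section E) : (forall y, W y -> u' y = (s y)`_a') ->
    \forall y \near x, u' y = chi x y *: (s y)`_a'.
  move=> hu; have [_ h1 _] := hb; have hW := open_nbhs_nbhs (conj oW Wx).
  by apply: filterS2 h1 hW => y -> /hu ->; rewrite scale1r.
have sa := smooth_bump_frame vE a ls hb; have sb := smooth_bump_frame vE b ls hb.
rewrite (br_near su sv sb (n1 b v _)); last by move=> y /uv[].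
rewrite (br_anti hL) // (br_near sb su sa (n1 a u _)); last by move=> y /uv[].
by rewrite -(br_anti hL).
Qed.

End GenLieAlgebroid.

(** * The Lie algebroid on the pull-back bundle *)

Section Pullback.
Context {R : realType} {m : nat} {M : manifold R m} {r : nat}.
Context {E : prebundle M r} {h hinv : M -> M}
  {rho : forall x, E x -> tangent_bundle M x}
  {br : section E -> section E -> section E}.
Hypothesis hG : gen_lie_algebroid h hinv rho br.
Implicit Types (u v w : section E) (f p q : M -> R) (x y : M).
Let F := pullback E h.
Implicit Types (U V W : section F).

Let Aop u : (M -> R) -> M -> R := vf_act (anchor_field h hinv rho u).
Let vE : vector_bundle E. Proof. by case: hG. Qed.
Let hK : cancel h hinv. Proof. by case: hG => _ []. Qed.
Let hinvK : cancel hinv h. Proof. by case: hG => _ []. Qed.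
Let sh : smooth_map h. Proof. by case: hG => _ []. Qed.
Let shinv : smooth_map hinv. Proof. by case: hG => _ []. Qed.
Let hL : lie_structure br Aop. Proof. by case: hG. Qed.

(** The value of U at hinv y lies in the fibre over h (hinv y), which is y only up to a proof; hence
    the transport. *)
Definition push_section (hinvK : cancel hinv h) (U : section (pullback E h)) : section E :=
  fun y => eq_rect (h (hinv y)) (fun z => E z : Type) (U (hinv y)) y (hinvK y).
Let push := push_section hinvK.

(** At a point h x the transport is along a proof of h x = h x and disappears by proof irrelevance;
    [section_ext_h] reduces equalities of sections of E to such points. *)
Lemma push_section_h U x : push U (h x) = U x.
Proof.
rewrite /push /push_section; move: (hinvK (h x)); rewrite hK => e.
by rewrite (Prop_irrelevance e erefl).
Qed.

Lemma section_ext_h (u v : section E) : (forall x, u (h x) = v (h x)) -> u = v.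
Proof.
by move=> uv; apply: functional_extensionality_dep => y; rewrite -(hinvK y).
Qed.

Definition pull_section (u : section E) : section F := fun x => u (h x).

Lemma pull_sectionK u : push (pull_section u) = u.
Proof. by apply: section_ext_h => x; rewrite push_section_h. Qed.

Lemma smooth_fun_hinv f : smooth_fun f -> smooth_fun (f \o hinv).
Proof. by move=> sf; have := smooth_fun_on_comp shinv openT sf; rewrite preimage_setT. Qed.

Lemma smooth_pull_on A u : open A -> smooth_section_on A u ->
  smooth_section_on (h @^-1` A) (pull_section u).
Proof.
move=> oA su _ [t tt <-] a.
have ot : open (A `&` fdom t) by apply: openI => //; exact/open_fdom/(triv_local_frame vE).
exact: (smooth_fun_on_comp sh ot (su t tt a)).
Qed.

Lemma smooth_pull u : smooth_section u -> smooth_section (pull_section u).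
Proof. by move=> su; have := smooth_pull_on openT su; rewrite preimage_setT. Qed.

Lemma smooth_push U : smooth_section U -> smooth_section (push U).
Proof.
move=> sU t tt a; rewrite setTI.
have ot : open (fdom t) by exact/open_fdom/(triv_local_frame vE).
have oht : open (h @^-1` fdom t).
  by apply: open_comp => // y _; exact: sh.1.
have := sU (pullback_frame h t) (ex_intro2 _ _ t tt erefl) a; rewrite setTI => s1.
have := smooth_fun_on_comp shinv oht s1.
rewrite (_ : hinv @^-1` (h @^-1` fdom t) = fdom t); last first.
  by apply/seteqP; split => y /=; rewrite hinvK.
apply: smooth_fun_on_eq => // y ty /=.
by rewrite -push_section_h -[in RHS](hinvK y).
Qed.

Lemma local_pullback_frame s : local_frame s ->
  local_frame (E := F) (pullback_frame h s).
Proof.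
move=> [os bs ss]; split => /=.
- by apply: open_comp => // y _; exact: sh.1.
- by move=> x sx; exact: bs.
- by move=> a; exact: (smooth_pull_on os (ss a)).
Qed.

Lemma vector_bundle_pullback : vector_bundle F.
Proof.
split => [_ [t tt <-]|x]; first exact/local_pullback_frame/(triv_local_frame vE).
by have [t tt tx] := triv_exists vE (h x); exists (pullback_frame h t) => //; exists t.
Qed.

Definition pullback_br U V : section F := pull_section (br (push U) (push V)).

Definition pullback_act U f x : R := Aop (push U) (f \o hinv) (h x).

Lemma push_lin f U V : push (fun x => f x *: U x + V x) =
  fun y => f (hinv y) *: push U y + push V y.
Proof. by apply: section_ext_h => x; rewrite !push_section_h hK. Qed.

Lemma push_scale f U : push (fun x => f x *: U x) =
  fun y => f (hinv y) *: push U y.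
Proof. by apply: section_ext_h => x; rewrite !push_section_h hK. Qed.

Lemma lie_structure_pullback : lie_structure pullback_br pullback_act.
Proof.
have [L1 [L2 [L3 [L4 [L5 L6]]]]] := hL.
have sp := smooth_push; split; last split; last split; last split; last split.
- by move=> U V sU sV; apply: smooth_pull; apply: L1; exact: sp.
- move=> k U V W sU sV sW x; rewrite /pullback_br /pull_section.
  rewrite (push_lin (fun=> k)); exact: L2 (sp _ sU) (sp _ sV) (sp _ sW) (h x).
- by move=> U V sU sV x; rewrite /pullback_br /pull_section L3 //; exact: sp.
- move=> U V W sU sV sW x; rewrite /pullback_br !pull_sectionK.
  exact: L4 (sp _ sU) (sp _ sV) (sp _ sW) (h x).
- move=> U V f sU sV sf x; rewrite /pullback_br /pull_section push_scale.
  rewrite [LHS](L5 _ _ (f \o hinv)); [|exact: sp|exact: sp|exact: smooth_fun_hinv].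
  by rewrite /= hK push_section_h.
- move=> U V f sU sV sf x.
  have e W : Aop (push W) (f \o hinv) = pullback_act W f \o hinv.
    by apply/funext => y; rewrite /pullback_act /= hinvK.
  rewrite {1}/pullback_act /pullback_br pull_sectionK.
  rewrite L6; [|exact: sp|exact: sp|exact: smooth_fun_hinv].
  by rewrite (e U) (e V).
Qed.

(** The identity defining the coefficients differentiates the composite with h; applied to f \o hinv
    it differentiates f itself, as the anchor of h^*E requires. *)
Lemma pullback_anchor_act : pullback_anchor hinv rho pullback_act.
Proof.
move=> c s cc ls U f sU sf x cx sx.
have := anchor_coefs_exist hG cc ls (smooth_push sU) (smooth_fun_hinv sf) cx sx.
rewrite push_section_h (_ : (f \o hinv) \o h = f) //.
by apply/funext => y; rewrite /= hK.
Qed.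

Lemma pullback_brackets_br : pullback_brackets hinv rho br pullback_br.
Proof.
split; first by exists pullback_act; [exact: pullback_anchor_act|exact: lie_structure_pullback].
move=> s ls a b U V W sU sV oW Ws UV x Wx.
have oW' : open (hinv @^-1` W) by apply: open_comp => // y _; exact: shinv.1.
have := bracket_coefs_exist hG ls (smooth_push sU) (smooth_push sV) oW'.
move=> /(_ a b); apply.
- by move=> y /= /Ws /=; rewrite hinvK.
- move=> y /= /UV [] /=; rewrite -(push_section_h U) -(push_section_h V).
  by rewrite hinvK.
- by rewrite /= hK.
Qed.

(** The transported bracket shows that the choice is possible; afterwards only the specification of
    the chosen bracket is used. *)
Lemma pullback_bracketP : pullback_brackets (h := h) hinv rho br (pullback_bracket hinv rho br).
Proof.
rewrite /pullback_bracket.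
by apply: (xgetPex ((fun _ _ _ => 0) : {classic section F -> section F -> section F}));
  exists pullback_br; exact: pullback_brackets_br.
Qed.

End Pullback.

(** * Coordinate frames *)

Section CoordFrame.
Context {R : realType} {m : nat} {M : manifold R m}.
Implicit Types (c d : chart R m M) (x : M).

Lemma coord_frameE c x (i : 'I_m) : (coord_frame c x)`_i =
  'D_(delta_mx 0 i : 'rV[R]_m) (cmap (chart_at x) \o cinv c) (cmap c x).
Proof. by rewrite -tnth_nth tnth_mktuple. Qed.

(** Chain rule for the identity map, written near the point as the passage from the preferred chart
    to c and back. *)
Lemma coord_frame_sum c x (v : 'rV[R]_m) : coordinates c -> cdom c x ->
  v = \sum_(i < m) tangent_coord c x v 0 i *: ((coord_frame c x)`_i : 'rV[R]_m).
Proof.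
move=> cc cx; have ac := chart_at_atlas x; have ax := chart_at_dom x.
have [oc _ cK _ _] := cc.1; have [_ oa aK _ _] := atlas_chart ac.
have df1 := transition_differentiable (cc.2 _ ac).2 ax cx.
have df2 := transition_differentiable (cc.2 _ ac).1 cx ax.
have yE : (cmap c \o cinv (chart_at x)) (cmap (chart_at x) x) = cmap c x.
  by rewrite /= aK.
rewrite -yE in df2.
have := derive_comp_rV v df1 df2; rewrite yE.
rewrite (@near_eq_derive _ _ _ _ id); last first.
  have h1 := near_cinv (atlas_chart ac) ax (open_nbhs_nbhs (conj oc cx)).
  have h2 : nbhs (cmap (chart_at x) x) (cmap (chart_at x) @` cdom (chart_at x)).
    by apply: open_nbhs_nbhs; split => //; exists x.
  apply: filterS2 h1 h2 => z cz [y ay yz]; move: cz; rewrite -yz /= aK // => cy.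
  by rewrite cK; [reflexivity|exact cy].
rewrite derive_id => {1}->; apply: eq_bigr => i _.
by rewrite coord_frameE.
Qed.

Lemma coord_frame_basis c x : coordinates c -> cdom c x ->
  basis_of fullv (coord_frame c x).
Proof.
move=> cc cx; rewrite basisEdim; apply/andP; split.
  apply/subvP => v _; rewrite (coord_frame_sum v cc cx).
  apply: memv_suml => i _; apply: memvZ; apply: memv_span; apply: mem_nth.
  by rewrite size_tuple.
by rewrite size_tuple dimvf /dim /= mul1n.
Qed.

Lemma coord_frame_coord c x (v : 'rV[R]_m) i : coordinates c -> cdom c x ->
  coord (coord_frame c x) i v = tangent_coord c x v 0 i.
Proof.
move=> cc cx; have fr := basis_free (coord_frame_basis cc cx).
rewrite {1}(coord_frame_sum v cc cx) linear_sum (bigD1 i) //= linearZ /=.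
rewrite coord_free // eqxx mulr1 big1 ?addr0 // => j ji.
by rewrite linearZ /= coord_free // (negbTE ji) mulr0.
Qed.

Lemma tangent_coord_frame c x (i j : 'I_m) : coordinates c -> cdom c x ->
  tangent_coord c x (coord_frame c x)`_i 0 j = (i == j)%:R.
Proof.
move=> cc cx; rewrite -coord_frame_coord //.
exact: (coord_free _ _ (basis_free (coord_frame_basis cc cx))).
Qed.

Lemma tangent_coord_change c d x i v : coordinates c -> coordinates d ->
  cdom c x -> cdom d x ->
  tangent_coord d x v 0 i =
  \sum_(j < m) tangent_coord c x v 0 j * pderiv c j (fun y => cmap d y 0 i) x.
Proof.
move=> cc cd cx dx; have [od _ _ _ _] := cd.1; have ac := chart_at_atlas x.
rewrite -(chart_change_derive v cc cx od dx (smooth_fun_on_coord i cd)).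
have df := transition_differentiable (cd.2 _ ac).2 (chart_at_dom x) dx.
by rewrite /tangent_coord derive_mx ?mxE //; exact: diff_derivable.
Qed.

Lemma smooth_pderiv c i A f : coordinates c -> open A -> A `<=` cdom c ->
  smooth_fun_on A f -> smooth_fun_on A (pderiv c i f).
Proof.
move=> cc oA Ac sf; have [_ _ cK _ _] := cc.1.
apply: (chart_smooth_on cc) => // k.
have [_ h] := smooth_on_chart cc oA sf k.+1.
apply: is_Ck_eq (h (delta_mx 0 i)); first exact: chart_open cc.1 oA.
by move=> _ [y [cy _] <-]; rewrite /pderiv /= cK.
Qed.

(** In the frame of another chart d the coordinates of d/dx^a are the partial derivatives along c of
    the coordinate functions of d. *)
Lemma local_coord_frame c : coordinates c ->
  local_frame (E := tangent_bundle M) (coord_frame c).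
Proof.
move=> cc; split => /=; first by have [] := cc.1.
  by move=> x cx; exact: coord_frame_basis.
move=> a _ [d ad <-] b /=; have cd := atlas_coordinates ad.
have oc : open (cdom c) by have [] := cc.1.
have od : open (cdom d) by have [] := cd.1.
have oA : open (cdom c `&` cdom d) by exact: openI.
apply: (@smooth_fun_on_eq _ _ _ _ (pderiv c a (fun y => cmap d y 0 b))) => //.
  move=> x [cx dx]; rewrite coord_frame_coord // (tangent_coord_change _ _ cc) //.
  rewrite (bigD1 a) //= tangent_coord_frame // eqxx mul1r big1 ?addr0 // => j ja.
  by rewrite tangent_coord_frame // eq_sym (negbTE ja) mul0r.
apply: (smooth_pderiv a cc oA); first by move=> x [].
by apply: smooth_fun_on_subset (smooth_fun_on_coord b cd) => x [].
Qed.

(** Provides global test functions that isolate the i-th component of a derivation at x. *)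
Lemma coord_extend c x i : coordinates c -> cdom c x ->
  exists2 f, smooth_fun f & \forall y \near x, f y = cmap c y 0 i.
Proof.
move=> cc cx; have oc : open (cdom c) by have [] := cc.1.
have [chi hb] := bump_exists oc cx; exists (fun y => chi y * cmap c y 0 i).
  exact: smooth_bumpM oc hb (smooth_fun_on_coord i cc).
by have [_ + _] := hb; apply: filterS => y ->; rewrite mul1r.
Qed.

Lemma christoffel_congr r c (P P' : 'I_r -> 'I_m -> M -> R)
    (L L' : 'I_r -> 'I_r -> 'I_r -> M -> R) (gS : M -> 'M[R]_r) a b e x :
  (forall a i, P a i x = P' a i x) -> (forall a b e, L a b e x = L' a b e x) ->
  christoffel c P L gS a b e x = christoffel c P' L' gS a b e x.
Proof.
move=> hP hL; rewrite /christoffel; congr (_ * _); apply: eq_bigr => d _.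
by congr (_ * (_ + _ - _ - _ - _ + _)); apply: eq_bigr => k _; rewrite ?hP ?hL.
Qed.

End CoordFrame.

(** * The case h = Id *)

Section Identity.
Context {R : realType} {m : nat} {M : manifold R m} {r : nat} {E : prebundle M r}
  {rho : forall x, E x -> tangent_bundle M x}
  {br : section E -> section E -> section E}.
Hypothesis hG : gen_lie_algebroid idfun idfun rho br.
Let vE : vector_bundle E. Proof. by case: hG. Qed.

(** The chosen coefficients are accessible only through their defining identity. An extension of s_a
    acting on an extension of the coordinate x^i reduces that identity to its (a, i) term, while
    [anchor_value] computes the same derivative from rho. *)
Lemma anchor_coef_id c (s : frame r E) a i x : coordinates c -> local_frame s ->
  cdom c x -> fdom s x ->
  anchor_coef idfun idfun rho c s a i x = morphism_coef rho c s a i x.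
Proof.
move=> cc ls cx sx; have [f sf fi] := coord_extend i cc cx.
have [u su ux] := frame_extend vE ls sx.
have {}ux := nbhs_singleton (ux a).
have df j : pderiv c j f x = (j == i)%:R.
  by rewrite (pderiv_eq j cc.1 cx fi) pderiv_coord.
have := anchor_coefs_exist hG cc ls (su a) sf cx sx.
have := anchor_value hG (u a) cc cx sf; rewrite /= => ->.
rewrite (bigD1 i) //= df eqxx mulr1 big1 ?addr0 => [|j ji]; last first.
  by rewrite df (negbTE ji) mulr0.
rewrite (bigD1 a) //= [X in _ + X]big1 ?addr0 => [|b ba]; last first.
  by apply: big1 => j _; rewrite ux frame_coord // (negbTE ba) !mul0r.
rewrite (bigD1 i) //= df ux frame_coord // !eqxx mulr1 mul1r big1 ?addr0 => [|j ji]; last first.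
  by rewrite df (negbTE ji) mulr0.
by move=> <-; rewrite /morphism_coef coord_frame_coord.
Qed.

End Identity.

(* Tested on coordinate functions, whose derivatives along the frame are locally
   constant, the commutator of the anchors vanishes without any appeal to the
   symmetry of second derivatives. *)
Lemma bracket_coef_coord_frame (R : realType) (m : nat) (M : manifold R m)
    (br : section (tangent_bundle M) -> section (tangent_bundle M) ->
          section (tangent_bundle M)) c a b e x :
  gen_lie_algebroid idfun idfun (fun x (v : tangent_bundle M x) => v) br ->
  coordinates c -> cdom c x -> bracket_coef br (coord_frame c) a b e x = 0.
Proof.
move=> hG cc cx; have vE : vector_bundle (tangent_bundle M) by case: hG.
pose Aop (w : section (tangent_bundle M)) :=
  vf_act (anchor_field idfun idfun (fun x (v : tangent_bundle M x) => v) w).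
have hL : lie_structure br Aop by case: hG.
have ls := local_coord_frame cc.
have [u su hu] := frame_extend vE ls cx.
have : nbhs x [set y | [/\ u a y = (coord_frame c y)`_a,
    u b y = (coord_frame c y)`_b & cdom c y]].
  have oc := open_nbhs_nbhs (conj (open_fdom ls) cx : open_nbhs x (cdom c)).
  by apply: filterS3 (hu a) (hu b) oc.
rewrite nbhsE => -[W [oW Wx] hW].
have Wc : W `<=` fdom (coord_frame c) by move=> y /hW[].
have hB : br (u a) (u b) x =
    \sum_(e < m) bracket_coef br (coord_frame c) a b e x *: (coord_frame c x)`_e.
  by apply: (bracket_coefs_exist hG ls (su a) (su b) oW Wc) => // y /hW[].
have [f sf fe] := coord_extend e cc cx.
have AE w p y : cdom c y -> smooth_fun p ->
    Aop w p y = \sum_(j < m) tangent_coord c y (w y) 0 j * pderiv c j p y.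
  by move=> cy sp; exact: (anchor_value hG w cc cy sp).
have df : \forall y \near x, forall j, pderiv c j f y = (j == e)%:R.
  have oc := open_nbhs_nbhs (conj (open_fdom ls) cx : open_nbhs x (cdom c)).
  apply: filterS2 oc (nbhs_interior fe) => y cy fy j.
  by rewrite (pderiv_eq j cc.1 cy fy) pderiv_coord.
have Af o : \forall y \near x, Aop (u o) f y = (o == e)%:R.
  have oc := open_nbhs_nbhs (conj (open_fdom ls) cx : open_nbhs x (cdom c)).
  apply: filterS3 oc df (hu o) => y cy dy uy.
  rewrite (AE _ _ _ cy sf) uy (bigD1 o) //= tangent_coord_frame // eqxx mul1r dy.
  by rewrite big1 ?addr0 // => j jo; rewrite tangent_coord_frame // eq_sym (negbTE jo) mul0r.
have AA o1 o2 : Aop (u o1) (Aop (u o2) f) x = 0.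
  rewrite AE //; last exact: (smooth_anchor vE hL a).
  apply: big1 => j _.
  by rewrite (pderiv_eq (g := cst (o2 == e)%:R) j cc.1 cx (Af o2)) pderiv_cst mulr0.
have [_ [_ [_ [_ [_ h6]]]]] := hL.
have := h6 _ _ _ (su a) (su b) sf x.
rewrite !AA subrr (AE _ _ _ cx sf) (bigD1 e) //= (nbhs_singleton df) eqxx mulr1.
rewrite big1 ?addr0 => [|j je]; last by rewrite (nbhs_singleton df) (negbTE je) mulr0.
rewrite -coord_frame_coord // hB linear_sum (bigD1 e) //= linearZ /=.
rewrite (frame_coord _ _ ls cx) eqxx mulr1 big1 ?addr0 // => f' fe'.
by rewrite linearZ /= (frame_coord _ _ ls cx) eq_sym (negbTE fe') mulr0.
Qed.

(** * The connection on the pull-back bundle *)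

Lemma rho_christoffel_levi_civita (R : realType) (m : nat) (M : manifold R m)
    (r : nat) (E : prebundle M r) (h hinv : M -> M)
    (rho : forall x, E x -> tangent_bundle M x)
    (br : section E -> section E -> section E) (g : tensor02 (pullback E h)) :
  gen_lie_algebroid h hinv rho br -> pseudometrical g ->
  let G := rho_christoffel hinv rho br g in
  exists D : section (pullback E h) -> section (pullback E h) ->
             section (pullback E h),
    [/\ linear_connection hinv rho G D,
        forall U V : section (pullback E h),
          smooth_section U -> smooth_section V ->
          forall x, torsion hinv rho br D U V x = 0 &
        compatible hinv rho G g].
Proof.
(* The anchor A is part of the specification of the bracket and is obtained together with it. *)
move=> hG pg G; have [[A anA hL] hLs] := pullback_bracketP hG.
have vE : vector_bundle E by case: hG.
have vF := vector_bundle_pullback hG.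
have lF s := local_pullback_frame hG (s := s).
have anP c s x : coordinates c -> local_frame s -> cdom c x -> fdom s (h x) ->
    anchor_at (A := A) c (pullback_frame h s) (anchor_coef h hinv rho c s) x.
  by move=> cc ls cx sx U f sU sf; exact: anA.
have hLoc x : exists c s P L, [/\ coordinates c, local_frame (E := pullback E h) s,
    cdom c x /\ fdom s x, anchor_at (A := A) c s P x &
    bracket_coefs (pullback_bracket hinv rho br) s L].
  have [t tt tx] := triv_exists vE (h x); have lt := triv_local_frame vE tt.
  have cc := chart_at_coordinates x; have cx := chart_at_dom x.
  exists (chart_at x), (pullback_frame h t), (anchor_coef h hinv rho (chart_at x) t).
  exists (fun a b e y => bracket_coef br t a b e (h y)).
  by split => //; [exact: lF|exact: anP|exact: hLs].
have hA x : exists c s P, [/\ coordinates c, cdom c x & anchor_at (A := A) c s P x].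
  by have [c [s [P [L [cc ls [cx sx] hP _]]]]] := hLoc x; exists c, s, P.
exists (levi_civita (B := pullback_bracket hinv rho br) (A := A) (g := g)); split.
- split => [U V sU sV|c s cc ls U V sU sV x cx sx S].
    exact: (smooth_levi_civita vF hL hA pg hLoc).
  exact: (levi_civita_local vF hL hA pg hLoc cc (lF s ls) cx sx
    (anP c s x cc ls cx sx) (hLs s ls)).
- by move=> U V sU sV x; exact: (levi_civita_torsion vF hL hA pg hLoc).
- move=> c s cc ls U sU x cx sx a b S gS; apply: big1 => e _.
  have [chi hb] := bump_exists (open_fdom (lF s ls)) sx.
  have h0 := christoffel_compat vF hL pg cc (lF s ls) cx sx (anP c s x cc ls cx sx)
    (hLs s ls) hb e a b.
  by rewrite [X in _ * X]h0 mulr0.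
Qed.

Unset Implicit Arguments.

Theorem theorem6p1 (R : realType) (m : nat) (M : manifold R m) :
  (forall (r : nat) (E : prebundle M r) (h hinv : M -> M)
          (rho : forall x, E x -> tangent_bundle M x)
          (br : section E -> section E -> section E)
          (g : tensor02 (pullback E h)),
     gen_lie_algebroid h hinv rho br -> pseudometrical g ->
     let G := rho_christoffel hinv rho br g in
     [/\ exists D : section (pullback E h) -> section (pullback E h) ->
                    section (pullback E h),
           [/\ linear_connection hinv rho G D,
                       forall U V : section (pullback E h),
                         smooth_section U -> smooth_section V ->
                         forall x, torsion hinv rho br D U V x = 0 &
                       compatible hinv rho G g],
         pseudometrizable h hinv rho &
         metrical g -> metrizable h hinv rho])
  /\
  (* h = Id *)
  (forall (r : nat) (E : prebundle M r)
          (rho : forall x, E x -> tangent_bundle M x)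
          (br : section E -> section E -> section E)
          (g : tensor02 E),
     gen_lie_algebroid idfun idfun rho br -> pseudometrical g ->
     forall (c : chart R m M) (s : frame r E), coordinates c -> local_frame s ->
     forall (a b e : 'I_r) (x : M), cdom c x -> fdom s x ->
       @rho_christoffel R m M r E idfun idfun rho br g c s a b e x =
       christoffel c (morphism_coef rho c s) (bracket_coef br s)
         (tensor_mx g s) a b e x)
  /\
  (* E = TM, rho = Id, h = Id, coordinate frames *)
  (forall (br : section (tangent_bundle M) -> section (tangent_bundle M) ->
                section (tangent_bundle M))
          (g : tensor02 (tangent_bundle M)),
     gen_lie_algebroid idfun idfun (fun x (v : tangent_bundle M x) => v) br ->
     pseudometrical g ->
     forall c : chart R m M, coordinates c ->
     forall (i j k : 'I_m) (x : M), cdom c x ->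
       let s : frame m (tangent_bundle M) := coord_frame c in
       let gS := tensor_mx g s in
       @rho_christoffel R m M m (tangent_bundle M) idfun idfun
         (fun x v => v) br g c s i j k x =
       2^-1 * \sum_(l < m) invmx (gS x) i l *
         (pderiv c k (fun y => gS y j l) x + pderiv c j (fun y => gS y l k) x
          - pderiv c l (fun y => gS y j k) x)).
Proof.
split; last split.
- move=> r E h hinv rho br g hG pg G.
  have [D hD] := rho_christoffel_levi_civita hG pg; have [h1 h2 h3] := hD.
  split; first by exists D.
    by exists g, G, D.
  by move=> mg; exists g, G, D.
- move=> r E rho br g hG pg c s cc ls a b e x cx sx.
  (* For h = Id the metric matrices and the bracket coefficients agree by conversion; only the
     anchor coefficients remain to be compared. *)
  by apply: christoffel_congr => // a' i; exact: (anchor_coef_id hG).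
- move=> br g hG pg c cc i j k x cx s gS.
  have ls := local_coord_frame cc.
  (* In a coordinate frame the components of the identity anchor are the Kronecker symbol, and the
     bracket coefficients are 0. *)
  pose P (a b : 'I_m) (y : M) : R := (a == b)%:R.
  transitivity (christoffel c P (fun _ _ _ _ => 0) gS i j k x).
    apply: christoffel_congr => [a l|a b e].
      rewrite (anchor_coef_id hG) // /morphism_coef.
      exact: (coord_free _ _ (basis_free (coord_frame_basis cc cx))).
    exact: bracket_coef_coord_frame.
  rewrite /christoffel; congr (_ * _); apply: eq_bigr => l _; congr (_ * _).
  have sumP (a : 'I_m) (F : 'I_m -> R) : \sum_(b < m) P a b x * F b = F a.
    rewrite (bigD1 a) //= /P eqxx mul1r big1 ?addr0 // => b ba.
    by rewrite eq_sym (negbTE ba) mul0r.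
  have sum0 (F : 'I_m -> R) : \sum_(b < m) 0 * F b = 0.
    by apply: big1 => b _; rewrite mul0r.
  by rewrite !sumP !sum0 !subr0 addr0.
Qed.
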